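(* Let $\Omega=\{x\in\mathbb{R}^2 : |x|>1\}$, let $\omega\in C^{0,\alpha}_c(\Omega)$ with $0<\alpha\le 1$, and let $\gamma\in\mathbb{R}$. Let $u_P=K_{\mathbb{R}^2}[\omega]$ and $u_R=u-u_P$ be the velocity fields defined in the context. For every integer $N\ge 2$ and $i=1,\dots,N$, set $$\theta_i^N=\frac{2\pi(i-1)}{N},\qquad \tilde\theta_i^N=\frac{2\pi(i-\frac12)}{N},\qquad x_i^N=(\cos\theta_i^N,\sin\theta_i^N),\qquad \tilde x_i^N=(\cos\tilde\theta_i^N,\sin\tilde\theta_i^N).$$ Then, for every $N\ge 2$, the linear system $$\frac1{2\pi}\sum_{j=1}^N \frac{\gamma_j^N}{N}\,\frac{(\tilde x_i^N-x_j^N)^\perp}{|\tilde x_i^N-x_j^N|^2}\cdot n(\tilde x_i^N)=-[u_P\cdot n](\tilde x_i^N)\quad (i=1,\dots,N-1),\qquad \sum_{i=1}^N\frac{\gamma_i^N}{N}=\gamma,$$ admits a unique solution $\gamma^N=(\gamma_1^N,\dots,\gamma_N^N)\in\mathbb{R}^N$. Moreover, setting $$u_{\rm app}^N(x)=\frac1{2\pi}\sum_{j=1}^N\frac{\gamma_j^N}{N}\,\frac{(x-x_j^N)^\perp}{|x-x_j^N|^2},\qquad x\in\Omega,$$ for any closed set $K\subset\mathbb{R}^2$ with $K\subset\Omega$ there exists a constant $C=C(K)$ independent of $N$ such that, for all $N\ge2$, $$\|u_R-u_{\rm app}^N\|_{L^\infty(K)}\le \frac{C}{N^2}.$$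
   Context: Notation: $(x_1,x_2)^\perp=(-x_2,x_1)$; $\operatorname{curl}u=\partial_1u_2-\partial_2u_1$; $C^{0,\alpha}_c(\Omega)$ is the space of real-valued $\alpha$-Hölder continuous functions (Lipschitz if $\alpha=1$) with compact support in $\Omega$, extended by zero to $\mathbb{R}^2$ when needed. On $\partial\Omega=\partial B(0,1)$, $n$ is the unit normal pointing into $\Omega$, i.e. $n(x)=x$, and $\tau=n^\perp$. The full plane velocity is $$u_P(x)=K_{\mathbb{R}^2}[\omega](x)=\frac1{2\pi}\int_{\mathbb{R}^2}\frac{(x-y)^\perp}{|x-y|^2}\,\omega(y)\,dy\in C^1(\mathbb{R}^2).$$ The velocity $u$ (in $C^1(\overline\Omega)$) is the unique solution of $$\operatorname{div}u=0 \text{ in }\Omega,\quad \operatorname{curl}u=\omega\text{ in }\Omega,\quad u\cdot n=0\text{ on }\partial\Omega,\quad u(x)\to0\text{ as }|x|\to\infty,\quad \oint_{\partial\Omega}u\cdot\tau\,ds=\gamma .$$ Equivalently, with $y^*=y/|y|^2$, it is given explicitly by $$u(x)=\frac1{2\pi}\int_\Omega\Big(\frac{x-y}{|x-y|^2}-\frac{x-y^*}{|x-y^*|^2}\Big)^\perp\omega(y)\,dy+\frac{1}{2\pi}\Big(\gamma+\int_\Omega\omega(y)\,dy\Big)\frac{x^\perp}{|x|^2}.$$ The remainder velocity is $u_R=u-u_P$ on $\overline\Omega$. *)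

(* Defs.v *)
From mathcomp Require Import all_boot all_order all_algebra.
From mathcomp Require Import all_classical all_reals all_analysis.
Import Order.TTheory GRing.Theory Num.Theory numFieldNormedType.Exports.

Set Implicit Arguments.
Unset Strict Implicit.
Unset Printing Implicit Defensive.

Local Open Scope classical_set_scope.
Local Open Scope ring_scope.

Notation leb2 := (lebesgue_measure \x lebesgue_measure)%E.

Section plane.
Context {R : realType}.
Implicit Types (x y z : R * R) (w : R * R -> R) (K : set (R * R)).

Definition dot x y : R := x.1 * y.1 + x.2 * y.2.

(* The Euclidean norm: the norm `| x | that R * R inherits as a product
   normed module is the sup norm. *)
Definition enorm x : R := Num.sqrt (dot x x).

Definition perp x : R * R := (- x.2, x.1).

(* z / |z| ^ 2, with value 0 at z = 0. As a function of z it is also the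
   inversion z^* with respect to the unit circle. *)
Definition inversion z : R * R := (enorm z ^+ 2)^-1 *: z.

Definition vintegral (D : set (R * R)) (f : R * R -> R * R) : R * R :=
  (\int[leb2]_(y in D) (f y).1, \int[leb2]_(y in D) (f y).2).

Definition Omega : set (R * R) := [set x | 1 < enorm x].

(* A function in C^{0,alpha}_c(Omega) is given directly by its extension by 0
   to the plane. *)
Definition holder_c (alpha : R) w : Prop :=
  [/\ compact (closure [set x | w x != 0]),
      closure [set x | w x != 0] `<=` Omega &
      exists M : R, forall x y, Omega x -> Omega y ->
        `|w x - w y| <= M * enorm (x - y) `^ alpha].

Definition plane_velocity w x : R * R :=
  (2 * pi)^-1 *: vintegral setT (fun y => w y *: perp (inversion (x - y))).

(* The Biot-Savart law of the exterior of the unit disk: the velocity that is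
   tangent to the circle, vanishes at infinity, and has vorticity w and
   circulation gamma. *)
Definition exterior_velocity w (gamma : R) x : R * R :=
  (2 * pi)^-1 *: vintegral Omega (fun y =>
      w y *: perp (inversion (x - y) - inversion (x - inversion y)))
  + ((2 * pi)^-1 * (gamma + \int[leb2]_(y in Omega) w y))
      *: perp (inversion x).

Definition remainder_velocity w gamma x : R * R :=
  exterior_velocity w gamma x - plane_velocity w x.

(* Indices start from 0: vortex N i is x_{i+1}^N, midpoint N i is its tilde
   counterpart. *)
Definition circle_point (t : R) : R * R := (cos t, sin t).

Definition vortex (N : nat) (i : 'I_N) : R * R :=
  circle_point (2 * pi * i%:R / N%:R).

Definition midpoint (N : nat) (i : 'I_N) : R * R :=
  circle_point (2 * pi * (i%:R + 2^-1) / N%:R).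

Definition normal x : R * R := x.

Definition app_velocity (N : nat) (g : 'rV[R]_N) x : R * R :=
  (2 * pi)^-1 *:
    \sum_(j < N) (g 0 j / N%:R) *: perp (inversion (x - vortex j)).

(* The tangency condition is imposed at all midpoints but the last. *)
Definition vortex_system (N : nat) w (gamma : R) (g : 'rV[R]_N) : Prop :=
  (forall i : 'I_N, (i.+1 < N)%N ->
     (2 * pi)^-1 * \sum_(j < N) g 0 j / N%:R *
       dot (perp (inversion (midpoint i - vortex j))) (normal (midpoint i))
     = - dot (plane_velocity w (midpoint i)) (normal (midpoint i)))
  /\ \sum_(i < N) g 0 i / N%:R = gamma.

Definition Linfty_norm K (f : R * R -> R * R) : \bar R :=
  Lnorm leb2 +oo%E (EFin \o ((enorm \o f) \_ K)).

End plane.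

(* Main.v *)
Require Import Defs.
From mathcomp Require Import all_boot all_order all_algebra.
From mathcomp Require Import all_classical all_reals all_analysis.
From mathcomp Require Import measurable_realfun ess_sup_inf complex ring lra.
Import Order.TTheory GRing.Theory Num.Theory numFieldNormedType.Exports.
Local Open Scope classical_set_scope.
Local Open Scope ring_scope.

(* With R * R read as the complex plane, the conjugate of a point vortex field
   is -i / (2 pi (z - e)), so every velocity is a superposition, weighted by w,
   of rational functions of the source e. The vortices are the N-th roots of 1
   and the midpoints those of -1; the tangency matrix is a discrete Hilbert
   transform (a cotangent kernel) whose Gram matrix is N^2/4 I - N/4 J. This
   gives the unique solvability and the stability of the system. Sampling the
   exact vortex sheet gamma + 2 Re (z / (z - e)) at the vortices gives a vector
   whose residual in the system, and whose velocity error outside the disk, are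
   explicit combinations of 1 / (z^N - 1) and 1 / (e^N - 1), hence of order
   N s^-N when |z|, |e| >= s > 1. By stability the solution inherits this
   bound, which is stronger than 1 / N^2. *)

Set Implicit Arguments.
Unset Strict Implicit.
Unset Printing Implicit Defensive.

(** * Sums over roots of unity *)

(** The sheet gamma + 2 Re (z / (z - e)) comes from the method of images. Outside the disk a source
    at e has the image field 1 / z - 1 / (z - u), with u = 1 / conj e, and this is also the field of
    a vortex sheet on the circle with that strength. Averaging over N equally spaced vortices is the
    trapezoidal rule for this field; its poles stay off the circle, which explains the geometric
    rate, and sums over roots of unity give the error in closed form. The tangency matrix has rank N
    - 1: it kills the constants and its columns sum to zero. One tangency condition therefore
    follows from the others, and the circulation takes its place. One obstacle shapes the estimates:
    a point x of K may lie in the support of w. The singular kernel 1 / (x - y) cancels in u_R, but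
    only after integrals are split, so its integrability has to be proved; and the identities for a
    single source must remain valid when z = e. *)

Section root_sums.
Context {F : fieldType} {N : nat} (a : F) (zeta : 'I_N -> F).
Hypothesis zetaN : forall j, zeta j ^+ N = a.
Hypothesis sum_zetaX : forall m, (0 < m < N)%N -> \sum_j zeta j ^+ m = 0.
Hypothesis N_gt0 : (0 < N)%N.

Lemma sub_root_neq0 z j : z ^+ N != a -> z - zeta j != 0.
Proof. by apply: contra; rewrite subr_eq0 => /eqP ->; rewrite zetaN. Qed.

(** The logarithmic derivative of z^N - a, obtained algebraically: z^N - a divided by z - [zeta j]
    is a polynomial in [zeta j], and only its constant term survives summation over j. *)
Lemma sum_root_inv z : z ^+ N != a ->
  \sum_j (z - zeta j)^-1 = N%:R * z ^+ N.-1 / (z ^+ N - a).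
Proof.
move=> zN; have zNa : z ^+ N - a != 0 by rewrite subr_eq0.
apply: (mulIf zNa); rewrite mulrVK ?unitfE// mulr_suml.
transitivity (\sum_j \sum_(i < N) z ^+ (N.-1 - i) * zeta j ^+ i).
  by apply: eq_bigr => j _; rewrite -(zetaN j) subrXX mulKf ?sub_root_neq0.
rewrite exchange_big/= (bigD1 (Ordinal N_gt0))//= [X in _ + X]big1 ?addr0.
  under eq_bigr do rewrite expr0 mulr1 subn0.
  by rewrite sumr_const card_ord mulr_natl.
move=> i i0; rewrite -mulr_sumr sum_zetaX ?mulr0// ltn_ord andbT lt0n.
by apply: contra i0 => /eqP i0; apply/eqP/val_inj.
Qed.

(** Replacing one factor [zeta j] by z - (z - [zeta j]) lowers the power by one; the leftover power
    sum vanishes as long as its exponent lies strictly between 0 and N. *)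
Lemma sum_root_moment z m : z ^+ N != a -> (m < N)%N ->
  \sum_j zeta j ^+ m.+1 / (z - zeta j) = N%:R * (a * z ^+ m / (z ^+ N - a)).
Proof.
move=> zN; have zNa : z ^+ N - a != 0 by rewrite subr_eq0.
elim: m => [|m IH] mN.
  transitivity (\sum_j (z / (z - zeta j) - 1)).
    by apply: eq_bigr => j _; have := sub_root_neq0 j zN => z0; field.
  rewrite sumrB -mulr_sumr sum_root_inv// sumr_const card_ord.
  have zE : z ^+ N = z * z ^+ N.-1 by rewrite -exprS prednK.
  by rewrite expr0; move: (z ^+ N.-1) zE zNa => p -> pa; field.
transitivity (\sum_j (z * (zeta j ^+ m.+1 / (z - zeta j)) - zeta j ^+ m.+1)).
  apply: eq_bigr => j _; have := sub_root_neq0 j zN => z0.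
  by rewrite [_ ^+ m.+2]exprS; field.
rewrite sumrB -mulr_sumr IH 1?ltnW// sum_zetaX ?mN// subr0 exprS; ring.
Qed.

End root_sums.

Section unity_root_sums.
Context {F : fieldType} {N : nat} (zeta : 'I_N -> F).
Hypothesis zetaN : forall j, zeta j ^+ N = 1.
Hypothesis sum_zetaX : forall m, (0 < m < N)%N -> \sum_j zeta j ^+ m = 0.
Hypothesis N_gt0 : (0 < N)%N.

(** Partial fractions would divide by z - e, which may vanish. Only 1 / (z - [zeta j]) is expanded,
    as a polynomial in [zeta j] over z^N - 1, and the moments at e finish the computation. *)
Lemma sum_unity_root_pair z e : z ^+ N != 1 -> e ^+ N != 1 ->
  \sum_j zeta j / (zeta j - e) / (z - zeta j)
  = - N%:R * ((\sum_(k < N) z ^+ (N.-1 - k) * e ^+ k)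
      / ((z ^+ N - 1) * (e ^+ N - 1))).
Proof.
move=> zN eN; have z1 : z ^+ N - 1 != 0 by rewrite subr_eq0.
have e1 : e ^+ N - 1 != 0 by rewrite subr_eq0.
transitivity (\sum_j \sum_(k < N) (- z ^+ (N.-1 - k) / (z ^+ N - 1)) *
    (zeta j ^+ k.+1 / (e - zeta j))).
  apply: eq_bigr => j _.
  have zj := sub_root_neq0 zetaN j zN; have ej := sub_root_neq0 zetaN j eN.
  rewrite -opprB invrN mulrN.
  have -> : (z - zeta j)^-1 = (\sum_(k < N) z ^+ (N.-1 - k) * zeta j ^+ k) /
      (z ^+ N - 1).
    rewrite -(zetaN j) subrXX.
    rewrite invfM mulrCA mulfV ?mulr1//.
    by apply: contraNneq z1 => S0; rewrite -(zetaN j) subrXX S0 mulr0.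
  rewrite mulr_suml mulr_sumr; apply: eq_bigr => k _.
  by rewrite [_ ^+ k.+1]exprS; field; rewrite z1 ej.
rewrite exchange_big/= mulr_suml mulr_sumr; apply: eq_bigr => k _.
rewrite -mulr_sumr (sum_root_moment zetaN)//; first by field; rewrite z1 e1.
Qed.

End unity_root_sums.

(** * The cotangent kernel and its Gram matrix *)

Section discrete_hilbert.
Context {F : fieldType} {N : nat} (zeta xi : 'I_N -> F).
Hypothesis zetaN : forall j, zeta j ^+ N = 1.
Hypothesis sum_zetaX : forall m, (0 < m < N)%N -> \sum_j zeta j ^+ m = 0.
Hypothesis zeta_inj : injective zeta.
Hypothesis xiN : forall j, xi j ^+ N = -1.
Hypothesis sum_xiX : forall m, (0 < m < N)%N -> \sum_j xi j ^+ m = 0.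
Hypothesis N_gt0 : (0 < N)%N.
Hypothesis two_neq0 : 2 != 0 :> F.

(** Equal to (xi + zeta) / (2 (xi - zeta)), that is cot ((a - b) / 2) / (2 i) for xi = exp (i a) and
    zeta = exp (i b). *)
Definition cot_kernel i j : F := xi i / (xi i - zeta j) - 2^-1.

Let N1 : -1 != 1 :> F.
Proof. by rewrite -subr_eq0 -opprD oppr_eq0. Qed.

Lemma xi_zeta i j : xi i - zeta j != 0.
Proof. by rewrite (sub_root_neq0 zetaN)// xiN. Qed.

Let row_sum i : \sum_j xi i / (xi i - zeta j) = N%:R / 2.
Proof.
rewrite -mulr_sumr (sum_root_inv zetaN)// ?xiN// mulrA mulrCA -exprS prednK//.
have -> : -1 - 1 = - 2 :> F by ring.
by rewrite xiN; field; rewrite ?oppr_eq0 two_neq0.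
Qed.

Lemma cot_kernel_row i : \sum_j cot_kernel i j = 0.
Proof.
rewrite /cot_kernel sumrB row_sum sumr_const card_ord -mulr_natl; ring.
Qed.

Let col_sum j : \sum_i xi i / (xi i - zeta j) = N%:R / 2.
Proof.
have zj : zeta j ^+ N != -1 by rewrite zetaN eq_sym.
transitivity (- \sum_i xi i ^+ 1 / (zeta j - xi i)).
  by rewrite -sumrN; apply: eq_bigr => i _; rewrite expr1 -opprB invrN mulrN.
by rewrite (sum_root_moment xiN)// zetaN expr0 opprK mulr1; field.
Qed.

Lemma cot_kernel_col j : \sum_i cot_kernel i j = 0.
Proof.
rewrite /cot_kernel sumrB col_sum sumr_const card_ord -mulr_natl; ring.
Qed.

(** For distinct poles the product of two kernels splits into partial fractions in [xi i], so the
    column sums already determine the answer. *)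
Lemma cot_kernel_ortho j k : j != k ->
  \sum_i cot_kernel i j * cot_kernel i k = N%:R / 4.
Proof.
move=> jk; have zjk : zeta j - zeta k != 0.
  by rewrite subr_eq0; apply: contra jk => /eqP/zeta_inj ->.
have four : (4 : F) != 0 by rewrite (_ : 4 = 2 * 2) ?mulf_neq0//; ring.
pose c := (zeta j - zeta k)^-1.
transitivity (\sum_i ((c * zeta j - 2^-1) * (xi i / (xi i - zeta j))
   - (c * zeta k + 2^-1) * (xi i / (xi i - zeta k)) + 4^-1)).
  apply: eq_bigr => i _; rewrite /cot_kernel /c.
  have ij := xi_zeta i j; have ik := xi_zeta i k.
  field; rewrite two_neq0 four zjk ij ik //.
rewrite big_split/= sumrB -!mulr_sumr !col_sum sumr_const card_ord -mulr_natl.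
by rewrite /c; field; rewrite two_neq0 four zjk.
Qed.

(* The diagonal value comes for free: the row sums of the Gram matrix vanish. *)
Lemma cot_kernel_gram j k :
  \sum_i cot_kernel i j * cot_kernel i k
  = N%:R / 4 - (j == k)%:R * N%:R ^+ 2 / 4.
Proof.
have [<-{k}|jk] := eqVneq j k; last by rewrite cot_kernel_ortho// !mul0r subr0.
have four : (4 : F) != 0 by rewrite (_ : 4 = 2 * 2) ?mulf_neq0//; ring.
have : \sum_k \sum_i cot_kernel i j * cot_kernel i k = 0.
  rewrite exchange_big/= big1// => i _.
  by rewrite -mulr_sumr cot_kernel_row mulr0.
rewrite (bigD1 j)//= => /eqP; rewrite addr_eq0 => /eqP ->.
rewrite (eq_bigr (fun=> N%:R / 4)); last first.
  by move=> i ij; rewrite cot_kernel_ortho// eq_sym.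
rewrite sumr_const -mulr_natl cardC1 card_ord.
have -> : N%:R = N.-1%:R + 1 :> F by rewrite natr1 prednK.
by rewrite mulr1n; field.
Qed.

End discrete_hilbert.

(** * Measure and integrability in the plane *)

Section plane_measure.
Context {R : realType}.
Implicit Types (x y : R * R).

Definition square x (r : R) : set (R * R) := ball x.1 r `*` ball x.2 r.

Lemma squareE x r : square x r = ball x r.
Proof. by []. Qed.

Lemma measurable_square x r : measurable (square x r).
Proof. by apply: measurableX; exact: measurable_ball. Qed.

Lemma leb2_square x r : 0 <= r -> leb2 (square x r) = ((2 * r) ^+ 2)%:E.
Proof.
move=> r0; rewrite /square product_measure1E; [|exact: measurable_ball..].
have E (t : R) : lebesgue_measure (ball t r) = (2 * r)%:E.
  by rewrite lebesgue_measure_ball// mulr_natl.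
by rewrite expr2 EFinM -{1}(E x.1) -(E x.2).
Qed.

(** The sigma-algebra of the plane is that of products, so an open set is written as the countable
    union of the rational squares that it contains. *)
Lemma measurable_open_plane (A : set (R * R)) : open A -> measurable A.
Proof.
move=> oA.
pose B (q : rat * rat * rat) : set (R * R) :=
  square (ratr q.1.1, ratr q.1.2) (ratr q.2).
rewrite (_ : A = \bigcup_q (if pselect (B q `<=` A) then B q else set0)).
  apply: countable_bigcupT_measurable => // q.
  by case: pselect => //= ?; exact: measurable_square.
apply/seteqP; split => [x Ax|x [q _]]; last by case: pselect => //= BA; exact: BA.
have [e /= e0 eA] : nbhs_ball x A by apply/nbhs_ballP; exact: oA.
(* A radius below e / 2 and a centre within r of x in each coordinate: the rational square contains
   x and stays inside [ball x e]. *)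
have [r /[!in_itv]/= /andP[r0 re]] := rat_in_itvoo (divr_gt0 e0 (ltr0Sn R 1)).
have r0' (t : R) : t - ratr r < t + ratr r by lra.
have [a /[!in_itv]/= /andP[a1 a2]] := rat_in_itvoo (r0' x.1).
have [b /[!in_itv]/= /andP[b1 b2]] := rat_in_itvoo (r0' x.2).
exists (a, b, r) => //; case: pselect => [?/=|[]].
  by split; rewrite /ball/= ltr_norml; apply/andP; split; lra.
move=> y [/= y1 y2]; apply: eA; move: y1 y2.
rewrite /ball/= !ltr_norml => /andP[? ?] /andP[? ?].
by split; rewrite /ball/= ltr_norml; apply/andP; split; lra.
Qed.

Lemma measurable_continuous_plane (f : R * R -> R) :
  continuous f -> measurable_fun setT f.
Proof.
move=> cf; apply: (measurability _ (RGenOInfty.measurableE R)).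
move=> _ [_ [a ->] <-]; rewrite setTI; apply: measurable_open_plane.
by move/continuousP: cf; apply; exact: interval_open.
Qed.

(** The inverse is totalised by the value 0 at 0, so the point 0 is treated apart and continuity is
    used on its open complement. *)
Lemma measurable_fun_inv d (T : measurableType d) (f : T -> R) :
  measurable_fun setT f -> measurable_fun setT (fun t => (f t)^-1).
Proof.
move=> mf; rewrite (_ : (fun t => _) = GRing.inv \o f)//.
apply: measurableT_comp => //.
rewrite (_ : setT = [set 0] `|` ~` [set 0] :> set R); last by rewrite setUv.
apply/measurable_funU => //; first exact: measurableC.
split; first exact: measurable_fun_set1.
apply: open_continuous_measurable_fun; first exact/closed_openC/closed_eq.
by move=> t; rewrite inE/= => /eqP t0; apply: cvgV.
Qed.


Lemma leb2_integrable_square x r : 0 <= r ->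
  leb2.-integrable setT (EFin \o (\1_(square x r) : R * R -> R)).
Proof.
move=> r0; have mS := measurable_square x r.
apply/integrableP; split; first exact/measurable_EFinP/measurable_indic.
under eq_integral do rewrite gee0_abs ?lee_fin//.
rewrite integral_indic// setIT.
by apply: le_lt_trans (ltry ((2 * r) ^+ 2)); rewrite -(leb2_square x r0).
Qed.

Lemma dyadic_exists (t : R) : 0 < t < 1 ->
  exists n, t < 2^-1 ^+ n /\ t^-1 <= 2 ^+ n.+1.
Proof.
move=> /andP[t0 t1].
have [n tn] : exists n, t^-1 <= 2 ^+ n.+1.
  exists (Num.truncn t^-1); apply: le_trans (_ : (Num.truncn t^-1).+1%:R <= _).
    by apply/ltW; exact: truncnS_gt.
  by rewrite -natrX ler_nat ltnW// ltn_expl.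
(* Descend to the least admissible n: when the bound fails for the smaller index, its failure is the
   required upper bound on t. *)
elim: n tn => [|n IH] tn; first by exists 0%N; rewrite expr0.
have [/IH//|tn'] := leP t^-1 (2 ^+ n.+1).
exists n.+1; split => //; rewrite exprVn -[t]invrK ltf_pV2 ?posrE ?invr_gt0//.
Qed.

(* 1 / |z| is at most 2^(n+1) on the shell 2^-(n+1) <= |z| < 2^-n. *)
Definition dyadic_series x y : \bar R :=
  (\sum_(n <oo) (2 ^+ n.+1 * \1_(square x (2^-1 ^+ n)) y)%:E)%E.

(** The summand 1 serves the points at distance at least 1, and y = x, where the inverse is 0 by
    convention. At any other point a single term of the series is large enough. *)
Lemma dyadic_seriesP x y : (`|x - y|^-1%:E <= 1 + dyadic_series x y)%E.
Proof.
have S0 n : (0 <= (2 ^+ n.+1 * \1_(square x (2^-1 ^+ n)) y)%:E :> \bar R)%E.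
  by rewrite lee_fin mulr_ge0// ?exprn_ge0.
have [x0|x1] := leP `|x - y|^-1 1.
  by apply: le_trans (_ : 1 <= _)%E; rewrite ?lee_fin// leeDl// nneseries_ge0.
have t0 : 0 < `|x - y|.
  by rewrite lt_neqAle normr_ge0 andbT eq_sym; apply: contraTneq x1 => ->;
     rewrite invr0 ltNge ler01.
have t1 : `|x - y| < 1.
  by rewrite -[_ < _]ltf_pV2 ?posrE// invr1.
have [n [tn nt]] := dyadic_exists (t:=`|x - y|) ltac:(by rewrite t0 t1).
apply: le_trans (_ : (\sum_(0 <= i < n.+1)
    (2 ^+ i.+1 * \1_(square x (2^-1 ^+ i)) y)%:E)%E <= _)%E; last first.
  apply: lee_paddl => //.
  by apply: nneseries_lim_ge => k _ _; exact: S0.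
rewrite big_nat_recr//= -[leLHS]add0e leeD//; first exact: sume_ge0.
rewrite indicE mem_set ?mulr1 ?lee_fin//.
by rewrite squareE -ball_normE.
Qed.

(** This is where dimension two enters: the n-th term integrates to 2^(n+1) times the area 4 * 4^-n,
    that is 8 * 2^-n, and the total is 16. *)
Lemma integrable_dyadic_series x : leb2.-integrable setT (dyadic_series x).
Proof.
have S0 n y : setT y ->
    (0 <= (2 ^+ n.+1 * \1_(square x (2^-1 ^+ n)) y)%:E :> \bar R)%E.
  by move=> _; rewrite lee_fin mulr_ge0// ?exprn_ge0.
have mS n : measurable_fun setT
    (fun y => (2 ^+ n.+1 * \1_(square x (2^-1 ^+ n)) y)%:E : \bar R).
  apply/measurable_EFinP; apply: measurable_funM => //.
  by apply: measurable_indic; apply: measurable_square.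
apply/integrableP; split.
  apply: (ge0_emeasurable_sum (P := xpredT)) => [k y Dy _|k _]; first exact: S0.
  exact: mS.
under eq_integral => y _ do
  rewrite gee0_abs ?(nneseries_ge0 (fun n _ _ => S0 n y Logic.I))//.
rewrite /dyadic_series integral_nneseries//.
apply: le_lt_trans (ltry (16 : R)).
apply: lime_le.
  by apply: is_cvg_nneseries => n _ _; apply: integral_ge0 => y; exact: S0.
apply: nearW => n.
apply: le_trans (_ : (16 - 16 * 2^-1 ^+ n)%:E <= _)%E; last first.
  by rewrite lee_fin gerBl mulr_ge0// exprn_ge0.
rewrite (eq_bigr (fun k => (8 * 2^-1 ^+ k)%:E)) => [|k _]; last first.
  under eq_integral do rewrite EFinM.
  rewrite ge0_integralZl_EFin//; last first.
    apply/measurable_EFinP; apply: measurable_indic; apply: measurable_square.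
  rewrite integral_indic//; last exact: measurable_square.
  rewrite setIT.
  transitivity (((2 ^+ k.+1)%:E * ((2 * (2^-1 ^+ k)) ^+ 2)%:E) : \bar R)%E.
    by congr (_ * _)%E; rewrite -(leb2_square x)// exprn_ge0.
  rewrite -EFinM; congr EFin; rewrite exprS exprMn.
  have -> : 2 * 2 ^+ k * (2 ^+ 2 * 2^-1 ^+ k ^+ 2) =
    8 * (2 ^+ k * 2^-1 ^+ k) * 2^-1 ^+ k :> R by ring.
  by rewrite -exprMn mulfV// expr1n mulr1.
elim: n => [|n IH]; first by rewrite big_nil expr0 lee_fin; lra.
rewrite big_nat_recr//=; apply: le_trans (leeD2r _ IH) _.
by rewrite -EFinD lee_fin exprS; lra.
Qed.

End plane_measure.

(** * Compactly supported sources and their integrability *)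

Section source.
Context {R : realType}.
Implicit Types (x y : R * R) (w : R * R -> R).

Lemma enorm_ge0 x : 0 <= enorm x.
Proof. exact: sqrtr_ge0. Qed.

Lemma enorm_le_norm x : enorm x <= 2 * `|x|.
Proof.
have n0 : 0 <= 2 * `|x| by rewrite mulr_ge0.
rewrite -(ler_pXn2r (n:=2)) ?nnegrE ?enorm_ge0// sqr_sqrtr; last first.
  by rewrite /dot addr_ge0// -expr2 sqr_ge0.
have h1 : `|x.1| <= `|x| by rewrite prod_normE le_max lexx.
have h2 : `|x.2| <= `|x| by rewrite prod_normE le_max lexx orbT.
rewrite /dot -!expr2 -(real_normK (num_real x.1)) -(real_normK (num_real x.2)).
have := normr_ge0 x.1; have := normr_ge0 x.2; nra.
Qed.

Lemma norm_le_enorm x : `|x| <= enorm x.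
Proof.
rewrite prod_normE ge_max; apply/andP; split.
  rewrite -sqrtr_sqr ler_wsqrtr// /dot -!expr2 lerDl sqr_ge0//.
by rewrite -sqrtr_sqr ler_wsqrtr// /dot -!expr2 lerDr sqr_ge0.
Qed.

Lemma enorm_continuous : continuous (@enorm R).
Proof.
move=> x; apply: (@continuous_comp _ _ _ (fun x => dot x x) Num.sqrt).
  by apply: cvgD; apply: cvgM; (exact: cvg_fst || exact: cvg_snd).
exact: sqrt_continuous.
Qed.

(** A closed subset of [Omega] may be unbounded, so the minimum of the norm is taken over its part
    in the compact square [Q]; outside [Q] the norm is at least 2. It is applied both to the set of
    the error bound and to the support of w. *)
Lemma closed_Omega_gap (K : set (R * R)) : closed K -> K `<=` Omega ->
  exists2 r : R, 1 < r & forall x, K x -> r <= enorm x.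
Proof.
move=> cK KO.
pose Q : set (R * R) := `[- 2, 2]%classic `*` `[- 2, 2]%classic.
have cQ : compact Q by apply: compact_setX; exact: segment_compact.
have cKQ : compact (K `&` Q).
  by rewrite setIC; exact: compact_closedI.
have out x : ~ Q x -> 2 <= enorm x.
  move=> Qx; rewrite leNgt; apply/negP => x2; apply: Qx.
  have := le_lt_trans (norm_le_enorm x) x2; rewrite prod_normE gt_max.
  by rewrite !ltr_norml => /andP[/andP[a b] /andP[c d]]; split;
    rewrite /= in_itv/=; apply/andP; split; exact: ltW.
have [KQ0|/set0P KQ0] := eqVneq (K `&` Q) set0.
  exists 2; first by rewrite ltr1n.
  move=> x Kx; apply: out => Qx.
  by have : (K `&` Q) x by []; rewrite KQ0.
have [|c] := @compact_EVT_min _ _ enorm _ KQ0 cKQ.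
  by apply: continuous_subspaceT; exact: enorm_continuous.
rewrite inE => -[Kc _] cmin.
exists (Num.min 2 (enorm c)); first by rewrite lt_min ltr1n; exact: KO.
move=> x Kx; have [Qx|/out x2] := pselect (Q x); last by rewrite ge_min x2.
by rewrite ge_min orbC cmin// inE.
Qed.

(** The Hölder estimate is available only inside [Omega]; a point outside [Omega] is off the closed
    support, and w vanishes near it. *)
Lemma holder_c_continuous alpha w :
  0 < alpha <= 1 -> holder_c alpha w -> continuous w.
Proof.
move=> /andP[a0 _] [_ sO [M hM]] x.
have [xO|xO] := pselect (Omega x); last first.
  have xs : ~ closure [set x | w x != 0] x by move/sO.
  have oS : open (~` closure [set x | w x != 0]).
    exact/closed_openC/closed_closure.
  have w0 y : ~ closure [set x | w x != 0] y -> w y = 0.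
    by move=> ys; apply: contra_notP ys => /eqP y0; exact: subset_closure.
  rewrite /continuous_at (w0 x xs); apply: cvg_near_cst.
  by near do rewrite w0//; exact: (open_nbhs_nbhs (conj oS xs)).
have oO : open (@Omega R).
  rewrite (_ : Omega = enorm @^-1` [set` `]1, +oo[ ]); last first.
    by apply/seteqP; split => y; rewrite /Omega/= in_itv/= andbT.
  move/continuousP: (@enorm_continuous); apply; exact: interval_open.
apply/cvgrPdist_lt => e e0.
(* Chosen so that d^alpha = e / (|M| + 1); the denominator is positive whatever the sign of the
   Hölder constant. *)
pose d := (e / (`|M| + 1)) `^ alpha^-1.
have M1 : 0 < `|M| + 1 by rewrite ltr_wpDl.
have d0 : 0 < d by rewrite powR_gt0// divr_gt0.
have nO : nbhs x Omega by exact: open_nbhs_nbhs.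
have nd : nbhs x (ball x (d / 2)) by apply: nbhsx_ballx; rewrite divr_gt0.
near=> y.
have yO : Omega y by near: y.
have yd : ball x (d / 2) y by near: y.
have xyd : enorm (x - y) < d.
  apply: le_lt_trans (enorm_le_norm _) _.
  by move: yd; rewrite -ball_normE/= => yd; lra.
apply: le_lt_trans (hM _ _ xO yO) _.
have : enorm (x - y) `^ alpha < d `^ alpha.
  by apply: gt0_ltr_powR; rewrite ?nnegrE ?enorm_ge0// ltW.
rewrite /d -powRrM mulVf ?gt_eqF// powRr1 ?divr_ge0 ?ltW//.
rewrite ltr_pdivlMr// => h.
apply: le_lt_trans h; rewrite mulrC ler_wpM2l ?powR_ge0//.
by have := ler_norm M; lra.
Unshelve. all: by end_near. Qed.

(* [s] separates the support of [w] from the disk, [L] bounds it. *)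
Definition source_bounds w (s M L : R) :=
  [/\ measurable_fun setT w, forall y, `|w y| <= M,
      forall y, w y != 0 -> s <= enorm y &
      forall y, w y != 0 -> square 0 L y].

Lemma holder_c_bounds alpha w : 0 < alpha <= 1 -> holder_c alpha w ->
  exists s M L, [/\ 1 < s, 0 <= M, 0 <= L & source_bounds w s M L].
Proof.
move=> a01 wa; have cw := holder_c_continuous a01 wa.
case: wa => cS SO _; set S := closure _ in cS SO.
have wS y : w y != 0 -> S y by move=> ?; exact: subset_closure.
have [s s1 Ss] := closed_Omega_gap (@closed_closure _ _) SO.
have /compact_bounded[L [_ SL]] := cS.
have /compact_bounded[M [_ SM]] : compact (w @` S).
  by apply: continuous_compact => //; exact: continuous_subspaceT.
have lt_norm1 (t : R) : t < `|t| + 1 by rewrite (le_lt_trans (ler_norm t))// ltrDl.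
(* [compact_bounded] gives the bounds for every real strictly above [M] and [L]; the further unit in
   the last witness makes room for the open square. *)
exists s, (`|M| + 1), (`|L| + 2); split => //; rewrite ?addr_ge0//.
split => //.
- exact: measurable_continuous_plane.
- move=> y; have [->|y0] := eqVneq (w y) 0; first by rewrite normr0 addr_ge0.
  by apply: (SM _ (lt_norm1 M)); exists y => //; exact: wS.
- by move=> y /wS; exact: Ss.
- move=> y /wS Sy; rewrite squareE -ball_normE/= sub0r normrN.
  by have /= := SL _ (lt_norm1 L) _ Sy; lra.
Qed.

Lemma integrable_source_bounded w s M L (f : R * R -> R) B : 0 <= L ->
  source_bounds w s M L -> measurable_fun setT f ->
  (forall y, w y != 0 -> `|f y| <= B) ->
  leb2.-integrable setT (EFin \o (fun y => w y * f y)).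
Proof.
move=> L0 [mw wM _ wL] mf fB.
have M0 : 0 <= M by apply: le_trans (wM 0).
refine (@le_integrable _ _ _ leb2 setT measurableT _
  (fun y => ((M * `|B|)%:E * (\1_(square 0 L) y)%:E)%E) _ _ _) => //.
- by apply/measurable_EFinP; exact: measurable_funM.
- move=> y _; rewrite /= lee_fin.
  have [w0|w0] := eqVneq (w y) 0; first by rewrite w0 mul0r normr0.
  rewrite indicE mem_set ?mulr1; last exact: wL.
  rewrite normrM (le_trans _ (ler_norm _))// ler_pM//.
  exact: le_trans (fB y w0) (ler_norm _).
- by apply: integrableZl => //; exact: leb2_integrable_square.
Qed.

(** The summand 1 of [dyadic_seriesP] is not integrable over the plane; since w vanishes outside the
    square, the indicator of the square can replace it. *)
Lemma integrable_source_singular w s M L x (f : R * R -> R) : 0 <= L ->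
  source_bounds w s M L -> measurable_fun setT f ->
  (forall y, `|f y| <= `|x - y|^-1) ->
  leb2.-integrable setT (EFin \o (fun y => w y * f y)).
Proof.
move=> L0 [mw wM _ wL] mf fB.
have M0 : 0 <= M by apply: le_trans (wM 0).
refine (@le_integrable _ _ _ leb2 setT measurableT _
  (fun y => M%:E * ((\1_(square 0 L) y)%:E + dyadic_series x y))%E _ _ _) => //.
- by apply/measurable_EFinP; exact: measurable_funM.
- move=> y _; have [w0|w0] := eqVneq (w y) 0.
    by rewrite /= w0 mul0r normr0 abse_ge0.
  rewrite indicE mem_set; last exact: wL.
  apply: le_trans (lee_abs _).
  rewrite /= normrM EFinM lee_pmul ?lee_fin//.
  by apply: le_trans (dyadic_seriesP x y); rewrite lee_fin.
- apply: integrableZl => //; apply: integrableD => //.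
    exact: leb2_integrable_square.
  exact: integrable_dyadic_series.
Qed.

End source.

(** * The complex plane and the circle *)

Section complex_plane.
Local Open Scope complex_scope.
Context {R : realType}.
Implicit Types (x y : R * R) (z : R[i]).

Definition toC x : R[i] := x.1 +i* x.2.

Lemma toCB x y : toC (x - y) = toC x - toC y.
Proof. by []. Qed.

Lemma toCZ (a : R) x : toC (a *: x) = a%:C * toC x.
Proof. by rewrite /toC; simpc. Qed.

Lemma toC_perp x : toC (perp x) = 'i * toC x.
Proof. by rewrite /toC; simpc. Qed.

Lemma normc_toC x : Normc.normc (toC x) = enorm x.
Proof. by rewrite /enorm /dot /= !expr2. Qed.

(** z / |z|^2 = 1 / conj z. Both sides are 0 at the origin by the convention on inverses, so no case
    has to be excluded. *)
Lemma toC_inversion x : toC (inversion x) = (conjc (toC x))^-1.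
Proof.
case: x => a b; rewrite /inversion /toC/= /enorm sqr_sqrtr /dot/=; last first.
  by rewrite addr_ge0// -expr2 sqr_ge0.
by apply/eqP; rewrite eq_complex /=; apply/andP; split; apply/eqP;
  rewrite sqrrN -!expr2 ?mulrN ?mulNr ?opprK mulrC.
Qed.

Lemma conjc_toC_inversion x : conjc (toC (inversion x)) = (toC x)^-1.
Proof. by rewrite toC_inversion conjc_inv conjcK. Qed.

Lemma ReD z1 z2 : complex.Re (z1 + z2) = complex.Re z1 + complex.Re z2.
Proof. by case: z1 z2 => ? ? []. Qed.

Lemma ReMreal (a : R) z : complex.Re (a%:C * z) = a * complex.Re z.
Proof. by case: z => b c /=; rewrite mul0r subr0. Qed.

Lemma Re_sum (I : Type) (r : seq I) (P : pred I) (F : I -> R[i]) :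
  complex.Re (\sum_(i <- r | P i) F i) = \sum_(i <- r | P i) complex.Re (F i).
Proof. by elim/big_rec2: _ => [|i a b _ <-]//; rewrite ReD. Qed.

Lemma conjcM z1 z2 : conjc (z1 * z2) = conjc z1 * conjc z2.
Proof. exact: rmorphM. Qed.

Lemma conjcD z1 z2 : conjc (z1 + z2) = conjc z1 + conjc z2.
Proof. exact: rmorphD. Qed.

Lemma conjcB z1 z2 : conjc (z1 - z2) = conjc z1 - conjc z2.
Proof. exact: rmorphB. Qed.

Lemma conjc_i : conjc 'i = - 'i :> R[i].
Proof. by simpc. Qed.

Lemma conjc_sum (I : Type) (r : seq I) (P : pred I) (F : I -> R[i]) :
  conjc (\sum_(i <- r | P i) F i) = \sum_(i <- r | P i) conjc (F i).
Proof. exact: rmorph_sum. Qed.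

Lemma dotE x y : dot x y = complex.Re (conjc (toC x) * toC y).
Proof. by rewrite /dot /=; ring. Qed.

Lemma normcX z n : Normc.normc (z ^+ n) = Normc.normc z ^+ n.
Proof.
elim: n => [|n IH]; first by rewrite !expr0 Normc.normc1.
by rewrite !exprS Normc.normcM IH.
Qed.

Lemma normc_ge0 z : 0 <= Normc.normc z.
Proof. by case: z => a b; exact: sqrtr_ge0. Qed.

Lemma normc_conjc z : Normc.normc (conjc z) = Normc.normc z.
Proof. by case: z => a b /=; rewrite sqrrN. Qed.

Lemma normc_real (a : R) : Normc.normc a%:C = `|a|.
Proof. by rewrite /= expr0n/= addr0 sqrtr_sqr. Qed.

Lemma le_normc_Re z : `|complex.Re z| <= Normc.normc z.
Proof. by case: z => a b /=; rewrite -sqrtr_sqr ler_wsqrtr// lerDl sqr_ge0. Qed.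

Lemma le_normc_Im z : `|complex.Im z| <= Normc.normc z.
Proof. by case: z => a b /=; rewrite -sqrtr_sqr ler_wsqrtr// lerDr sqr_ge0. Qed.

Lemma normc_le_ReIm z : Normc.normc z <= `|complex.Re z| + `|complex.Im z|.
Proof.
rewrite {1}[z]complexE; apply: le_trans (le_normcD _ _) _.
by rewrite normc_real Normc.normcM normc_real /= expr0n/= add0r expr1n sqrtr1 mul1r.
Qed.

Lemma le_normcB z1 z2 : Normc.normc (z1 - z2) <= Normc.normc z1 + Normc.normc z2.
Proof. by apply: le_trans (le_normcD _ _) _; rewrite lerD2l; rewrite -[leRHS](normcN z2). Qed.

Lemma le_normc_sum (I : Type) (r : seq I) (P : pred I) (F : I -> R[i]) :
  Normc.normc (\sum_(i <- r | P i) F i) <= \sum_(i <- r | P i) Normc.normc (F i).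
Proof.
elim/big_rec2: _ => [|i a b _ h]; first by rewrite Normc.normc0.
by apply: le_trans (le_normcD _ _) _; rewrite lerD2l.
Qed.

Lemma normc_eq0 z : (Normc.normc z == 0) = (z == 0).
Proof.
by apply/eqP/eqP => [/Normc.eq0_normc//|->]; rewrite Normc.normc0.
Qed.

Lemma lerB_normcB z1 z2 :
  Normc.normc z1 - Normc.normc z2 <= Normc.normc (z1 - z2).
Proof. by rewrite lerBlDr; rewrite -{1}[z1](subrK z2) le_normcD. Qed.

End complex_plane.

(** * Vortices and midpoints as roots of 1 and of -1 *)

Section circle_points.
Local Open Scope complex_scope.
Context {R : realType}.

Definition cis (t : R) : R[i] := toC (circle_point t).

Lemma cisD s t : cis (s + t) = cis s * cis t.
Proof. by rewrite /cis /toC /= cosD sinD; simpc; congr (_ +i* _); ring. Qed.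

Lemma cis0 : cis 0 = 1.
Proof. by rewrite /cis /toC /= cos0 sin0. Qed.

Lemma cisX t n : cis t ^+ n = cis (n%:R * t).
Proof.
elim: n => [|n IH]; first by rewrite expr0 mul0r cis0.
by rewrite exprS IH -cisD -natr1 mulrDl mul1r addrC.
Qed.

Lemma normc_cis t : Normc.normc (cis t) = 1.
Proof. by rewrite /= cos2Dsin2 sqrtr1. Qed.

Lemma conjc_cis t : conjc (cis t) = (cis t)^-1.
Proof.
have c0 : cis t != 0 by rewrite -normc_eq0 normc_cis oner_eq0.
apply: (mulIf c0); rewrite mulVf//.
rewrite /cis /toC/=; simpc; apply/eqP; rewrite eq_complex/=.
by rewrite -!expr2 cos2Dsin2 eqxx/=; apply/eqP; ring.
Qed.

Variables (N : nat).
Hypothesis N_gt0 : (0 < N)%N.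

Let N0 : N%:R != 0 :> R. Proof. by rewrite pnatr_eq0 -lt0n. Qed.

Definition unit_root : R[i] := cis (2 * pi / N%:R).

Lemma unit_rootN : unit_root ^+ N = 1.
Proof.
by rewrite cisX mulrC divfK// /cis /toC/= mulr_natl cos2pi sin2pi.
Qed.

(** The real part is cos 2t with t = m pi / N in (0, pi); there sin t > 0, so cos 2t < 1. *)
Lemma unit_root_neq1 m : (0 < m < N)%N -> unit_root ^+ m != 1.
Proof.
move=> /andP[m0 mN]; rewrite cisX; apply/eqP => /(congr1 (@complex.Re _))/=.
pose t : R := m%:R * (pi / N%:R).
have -> : m%:R * (2 * pi / N%:R) = t *+ 2 by rewrite /t -mulr_natl; field.
rewrite cos_mulr2n.
have : 0 < sin t.
  apply: sin_gt0_pi; rewrite mulr_gt0 ?ltr0n ?divr_gt0 ?pi_gt0 ?ltr0n//=.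
  rewrite /t mulrCA gtr_pMr ?pi_gt0// ltr_pdivrMr ?ltr0n// mul1r ltr_nat//.
have := cos2Dsin2 t.
move=> h1 h2; rewrite -mulr_natl => h3.
have : 0 < sin t ^+ 2 by rewrite exprn_gt0.
lra.
Qed.

Lemma sum_unit_rootX m : (0 < m < N)%N -> \sum_(j < N) (unit_root ^+ m) ^+ j = 0.
Proof.
move=> mN; have := unit_root_neq1 mN; rewrite -subr_eq0 => m1; apply: (mulfI m1).
by rewrite mulr0 -subrX1 -exprM mulnC exprM unit_rootN expr1n subrr.
Qed.

Lemma toC_vortex (j : 'I_N) : toC (vortex j : R * R) = unit_root ^+ j.
Proof. by rewrite cisX /cis; congr (toC (circle_point _)); field. Qed.

Lemma toC_midpoint (j : 'I_N) :
  toC (midpoint j : R * R) = cis (pi / N%:R) * unit_root ^+ j.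
Proof.
rewrite cisX -cisD /midpoint/cis; congr (toC (circle_point _)).
by field.
Qed.

Lemma vortexN (j : 'I_N) : toC (vortex j : R * R) ^+ N = 1.
Proof. by rewrite toC_vortex -exprM mulnC exprM unit_rootN expr1n. Qed.

Lemma midpointN (j : 'I_N) : toC (midpoint j : R * R) ^+ N = -1.
Proof.
rewrite toC_midpoint exprMn -exprM mulnC exprM unit_rootN expr1n mulr1.
by rewrite cisX mulrC divfK// /cis/toC/= cospi sinpi; simpc.
Qed.

Lemma sum_vortexX m : (0 < m < N)%N ->
  \sum_(j < N) toC (vortex j : R * R) ^+ m = 0.
Proof.
move=> /sum_unit_rootX S0; rewrite -[RHS]S0; apply: eq_bigr => j _.
by rewrite toC_vortex -!exprM mulnC.
Qed.

Lemma sum_midpointX m : (0 < m < N)%N ->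
  \sum_(j < N) toC (midpoint j : R * R) ^+ m = 0.
Proof.
move=> /sum_unit_rootX S0.
transitivity (cis (pi / N%:R) ^+ m * \sum_(j < N) (unit_root ^+ m) ^+ j).
  rewrite mulr_sumr; apply: eq_bigr => j _.
  by rewrite toC_midpoint exprMn -!exprM mulnC.
by rewrite S0 mulr0.
Qed.

Lemma vortex_inj : injective (fun j : 'I_N => toC (vortex j : R * R)).
Proof.
have r0 : unit_root != 0 by rewrite -normc_eq0 normc_cis oner_eq0.
suff lt_neq (j k : 'I_N) : (j < k)%N -> toC (vortex j : R * R) <> toC (vortex k).
  move=> j k jk; apply/val_inj/eqP; case: ltngtP => // h; exfalso.
    exact: (lt_neq _ _ h).
  exact: (lt_neq _ _ h).
move=> jk; rewrite !toC_vortex -(subnKC (ltnW jk)) exprD -[LHS]mulr1.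
move=> /(mulfI (expf_neq0 _ r0))/esym/eqP; apply/negP/unit_root_neq1.
by rewrite subn_gt0 jk (leq_ltn_trans (leq_subr _ _)).
Qed.

Lemma normc_vortex (j : 'I_N) : Normc.normc (toC (vortex j : R * R)) = 1.
Proof. exact: normc_cis. Qed.

Lemma normc_midpoint (j : 'I_N) : Normc.normc (toC (midpoint j : R * R)) = 1.
Proof. exact: normc_cis. Qed.

End circle_points.

(** * The tangency matrix *)

Section tangency.
Local Open Scope complex_scope.
Context {R : realType} {n : nat}.
Local Notation N := n.+1.

Definition tangency_kernel (i j : 'I_N) : R :=
  dot (perp (inversion (midpoint i - vortex j))) (normal (midpoint i)).

Local Notation zeta := (fun j : 'I_N => toC (vortex j : R * R)).
Local Notation xi := (fun i : 'I_N => toC (midpoint i : R * R)).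

Let N0 : N%:R != 0 :> R. Proof. by rewrite pnatr_eq0. Qed.

Lemma midpoint_neq_vortex (i j : 'I_N) : xi i - zeta j != 0.
Proof.
apply: (@xi_zeta _ _ zeta xi (vortexN _) (midpointN _)) => //.
Qed.

(** On the circle conjugation is inversion, so x / (x - z) has conjugate -z / (x - z) = 1 - x / (x -
    z). Its real part is thus 1/2, and subtracting 1/2 leaves 'i times its imaginary part, which is
    the normal velocity. *)
Lemma tangency_kernelE i j :
  'i * (tangency_kernel i j)%:C = cot_kernel zeta xi i j.
Proof.
have d0 := midpoint_neq_vortex i j.
have z0 : zeta j != 0 by rewrite -normc_eq0 normc_cis oner_eq0.
have x0 : xi i != 0 by rewrite -normc_eq0 normc_cis oner_eq0.
have two0 : 2 != 0 :> R[i] by rewrite pnatr_eq0.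
have i2 : 'i * 'i = -1 :> R[i] by rewrite -expr2 sqr_i.
have -> : tangency_kernel i j = complex.Re (- 'i * (xi i / (xi i - zeta j))).
  rewrite /tangency_kernel dotE toC_perp conjcM conjc_toC_inversion toCB.
  by rewrite conjc_i -mulrA [_^-1 * _]mulrC.
have xC : conjc (xi i) = (xi i)^-1 by exact: conjc_cis.
have zC : conjc (zeta j) = (zeta j)^-1 by exact: conjc_cis.
rewrite ReJ_add !conjcM conjc_inv conjcB xC zC -[- 'i]conjc_i conjcK conjc_i.
rewrite /cot_kernel /=.
move: (xi i) (zeta j) d0 z0 x0 => x z d0 z0 x0.
have d1 : x^-1 - z^-1 != 0.
  by rewrite subr_eq0 (inj_eq invr_inj) -subr_eq0.
have -> : x^-1 / (x^-1 - z^-1) = - z / (x - z).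
  by apply: (mulIf d1); rewrite mulfVK//; field; rewrite x0 z0 d0.
pose I : R[i] := 'i.
change (I * ((- I * (x / (x - z)) + I * (- z / (x - z))) / 2)
  = x / (x - z) - 2^-1).
have {}i2 : I * I = -1 by [].
transitivity (- (I * I) * ((x + z) / (x - z) / 2)); first by field; rewrite ?two0 ?d0.
by rewrite i2; field; rewrite ?two0 ?d0.
Qed.

Lemma tangency_kernel_row i : \sum_j tangency_kernel i j = 0.
Proof.
have i0 : 'i != 0 :> R[i] by rewrite eq_complex/= oner_eq0 andbF.
apply: complexI; apply: (mulfI i0); rewrite rmorph_sum rmorph0 mulr0 mulr_sumr.
under eq_bigr do rewrite tangency_kernelE.
apply: cot_kernel_row; do ?[exact: vortexN|exact: sum_vortexX|exact: vortex_inj|exact: midpointN|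
  exact: sum_midpointX|by []|by rewrite pnatr_eq0].
Qed.

Lemma tangency_kernel_col j : \sum_i tangency_kernel i j = 0.
Proof.
have i0 : 'i != 0 :> R[i] by rewrite eq_complex/= oner_eq0 andbF.
apply: complexI; apply: (mulfI i0); rewrite rmorph_sum rmorph0 mulr0 mulr_sumr.
under eq_bigr do rewrite tangency_kernelE.
apply: cot_kernel_col; do ?[exact: vortexN|exact: sum_vortexX|exact: vortex_inj|exact: midpointN|
  exact: sum_midpointX|by []|by rewrite pnatr_eq0].
Qed.

Lemma tangency_kernel_gram j k :
  \sum_i tangency_kernel i j * tangency_kernel i k
  = (j == k)%:R * N%:R ^+ 2 / 4 - N%:R / 4.
Proof.
apply: complexI; apply: oppr_inj; rewrite rmorph_sum/= -sumrN.
transitivity (\sum_i cot_kernel zeta xi i j * cot_kernel zeta xi i k).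
  apply: eq_bigr => i _; rewrite -!tangency_kernelE rmorphM mulrACA.
  by rewrite -expr2 sqr_i mulN1r.
rewrite cot_kernel_gram; do ?[exact: vortexN|exact: sum_vortexX|exact: vortex_inj|exact: midpointN|
  exact: sum_midpointX|by []|by rewrite pnatr_eq0].
by rewrite rmorphB !rmorphM !fmorphV/= !rmorph_nat opprB expr2.
Qed.

(** A diagonal Gram entry is a sum of squares equal to N^2 / 4 - N / 4, so it dominates the square
    of each entry of its column. *)
Lemma tangency_kernel_le i j : `|tangency_kernel i j| <= N%:R / 2.
Proof.
have Nhalf : 0 <= N%:R / 2 :> R by rewrite divr_ge0.
rewrite -(ler_pXn2r (n:=2)) ?nnegrE// real_normK ?num_real//.
have := tangency_kernel_gram j j; rewrite eqxx mul1r (bigD1 i)//= -expr2 => kE.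
have : 0 <= \sum_(l < N | l != i) tangency_kernel l j * tangency_kernel l j.
  by apply: sumr_ge0 => l _; rewrite -expr2 sqr_ge0.
have : 0 <= N%:R / 4 :> R by rewrite divr_ge0.
rewrite expr_div_n; have -> : 2 ^+ 2 = 4 :> R by ring.
by move: kE; lra.
Qed.

(** The Gram identity says that applying the matrix and then its transpose gives N^2 / 4 times g
    minus N / 4 times the sum of g; this is solved for g. *)
Lemma tangency_inverse (g : 'I_N -> R) k :
  g k = (\sum_j g j) / N%:R + 4 / N%:R ^+ 2 *
    \sum_i tangency_kernel i k * (\sum_j tangency_kernel i j * g j).
Proof.
have -> : \sum_i tangency_kernel i k * (\sum_j tangency_kernel i j * g j)
    = g k * N%:R ^+ 2 / 4 - (\sum_j g j) * (N%:R / 4).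
  under eq_bigr do rewrite mulr_sumr.
  rewrite exchange_big/= mulr_suml.
  transitivity (\sum_j g j * ((k == j)%:R * N%:R ^+ 2 / 4 - N%:R / 4)).
    apply: eq_bigr => j _; rewrite -tangency_kernel_gram mulr_sumr.
    by apply: eq_bigr => i _; ring.
  under eq_bigr do rewrite mulrBr.
  rewrite sumrB; congr (_ - _).
  rewrite (bigD1 k)//= eqxx big1 ?addr0; first by rewrite mul1r mulrA.
  by move=> j; rewrite eq_sym => /negPf ->; rewrite !mul0r mulr0.
by field.
Qed.

(* The columns of the kernel sum to zero, so the last, unimposed, tangency
   condition is controlled by the others. *)
Lemma tangency_stability (g : 'I_N -> R) (b : R) k : 0 <= b ->
  (forall i : 'I_N, (i.+1 < N)%N -> `|\sum_j tangency_kernel i j * g j| <= b) ->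
  `|g k| <= `|(\sum_j g j) / N%:R| + 4 * b.
Proof.
move=> b_ge0 gb; pose t i := \sum_j tangency_kernel i j * g j.
have t0 : \sum_i t i = 0.
  rewrite exchange_big/= big1// => j _.
  by rewrite -mulr_suml tangency_kernel_col mul0r.
(* The last residual is minus the sum of the n others, so it costs at most as much as all of them
   together. *)
have st : \sum_i `|t i| <= 2 * (n%:R * b).
  have sb : \sum_(i < n) `|t (widen_ord (leqnSn n) i)| <= n%:R * b.
    rewrite mulr_natl -[X in _ *+ X](card_ord n) -sumr_const.
    by apply: ler_sum => i _; apply: gb; rewrite ltnS /=.
  rewrite big_ord_recr/= mulrDl mul1r lerD//.
  move: t0; rewrite big_ord_recr/= => /eqP; rewrite addrC addr_eq0 => /eqP ->.
  by rewrite normrN; apply: le_trans (ler_norm_sum _ _ _) sb.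
have -> : g k = (\sum_j g j) / N%:R
    + 4 / N%:R ^+ 2 * \sum_i tangency_kernel i k * t i by exact: tangency_inverse.
apply: le_trans (ler_normD _ _) _.
rewrite lerD2l normrM.
have -> : `|4 / N%:R ^+ 2| = 4 / N%:R ^+ 2 :> R.
  by rewrite ger0_norm// divr_ge0// exprn_ge0.
(* The entry bound N / 2 and the bound 2 n b on the residuals leave 4 n b / N, which is at most 4 b
   because n = N - 1. *)
apply: le_trans (_ : 4 / N%:R ^+ 2 * (N%:R / 2 * (2 * (n%:R * b))) <= _).
  rewrite ler_wpM2l ?divr_ge0 ?exprn_ge0//.
  apply: le_trans (ler_norm_sum _ _ _) _.
  apply: le_trans (_ : N%:R / 2 * \sum_i `|t i| <= _); last first.
    by rewrite ler_wpM2l// divr_ge0.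
  rewrite mulr_sumr; apply: ler_sum => i _.
  by rewrite normrM ler_wpM2r// tangency_kernel_le.
have -> : 4 / N%:R ^+ 2 * (N%:R / 2 * (2 * (n%:R * b))) = 4 * (n%:R * b) / N%:R.
  by field.
rewrite ler_pdivrMr ?ltr0n// -mulrA ler_pM2l// mulrC ler_wpM2l//.
by rewrite ler_nat.
Qed.

(** The last tangency condition gives way to the sum condition, so the system is square. Stability
    with zero data shows that its matrix has trivial kernel, which yields existence and uniqueness
    at once. [M] is transposed because the unknown is a row vector. *)
Lemma tangency_solvable (f : 'I_N -> R) (gamma : R) :
  exists! g : 'rV[R]_N,
    (forall i : 'I_N, (i.+1 < N)%N -> \sum_j tangency_kernel i j * g 0 j = f i)
    /\ \sum_j g 0 j = gamma.
Proof.
pose M : 'M[R]_N :=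
  \matrix_(j, i) if (i.+1 < N)%N then tangency_kernel i j else 1.
pose r : 'rV[R]_N := \row_i if (i.+1 < N)%N then f i else gamma.
have lastP (i : 'I_N) : ~~ (i.+1 < N)%N -> i = ord_max.
  by rewrite ltnS -leqNgt => ni; apply/val_inj/eqP; rewrite eqn_leq ni -ltnS ltn_ord.
have gM (g : 'rV[R]_N) i : (g *m M) 0 i =
    if (i.+1 < N)%N then \sum_j tangency_kernel i j * g 0 j else \sum_j g 0 j.
  rewrite mxE; case: ifP => iN; apply: eq_bigr => j _; rewrite mxE iN ?mulr1//.
  by rewrite mulrC.
have sysE (g : 'rV[R]_N) : g *m M = r <->
    (forall i : 'I_N, (i.+1 < N)%N -> \sum_j tangency_kernel i j * g 0 j = f i)
    /\ \sum_j g 0 j = gamma.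
  split=> [gr|[gf gs]].
    split=> [i iN|]; first by have := gM g i; rewrite iN gr mxE iN.
    by have := gM g ord_max; rewrite gr mxE /= ltnn.
  by apply/rowP => i; rewrite gM mxE; case: ifP => // iN; exact: gf.
have Mu : M \in unitmx.
  rewrite -row_free_unit; apply: inj_row_free => g gM0.
  apply/rowP => k; rewrite mxE; apply/eqP; rewrite -normr_eq0 eq_le normr_ge0 andbT.
  have [gk gs] : (forall i : 'I_N, (i.+1 < N)%N ->
      `|\sum_j tangency_kernel i j * g 0 j| <= 0) /\ \sum_j g 0 j = 0.
    split=> [i iN|]; first by have := gM g i; rewrite gM0 iN mxE => <-; rewrite normr0.
    by have := gM g ord_max; rewrite gM0 mxE /= ltnn.
  have := tangency_stability (g := fun j => g 0 j) k (lexx 0) gk.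
  by rewrite gs mul0r normr0 mulr0 addr0.
exists (r *m invmx M); split; first by apply/sysE; rewrite mulmxKV.
by move=> g /sysE <-; rewrite mulmxK.
Qed.

End tangency.

(** * Superposition of sources *)

Section superposition.
Local Open Scope complex_scope.
Context {R : realType} (w : R * R -> R).
Implicit Types (F G : R * R -> R[i]) (c : R[i]).
Local Notation Re := complex.Re.
Local Notation Im := complex.Im.

Definition cmeasurable F :=
  measurable_fun setT (fun y => Re (F y)) /\
  measurable_fun setT (fun y => Im (F y)).

Definition superposable F :=
  leb2.-integrable setT (EFin \o (fun y => w y * Re (F y))) /\
  leb2.-integrable setT (EFin \o (fun y => w y * Im (F y))).

Definition superpose F : R[i] :=
  (\int[leb2]_y (w y * Re (F y))) +i* (\int[leb2]_y (w y * Im (F y))).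

Lemma cmeasurable_cst c : cmeasurable (fun=> c).
Proof. by split; exact: measurable_cst. Qed.

Lemma cmeasurable_toC : cmeasurable toC.
Proof. by split; [exact: measurable_fst|exact: measurable_snd]. Qed.

Lemma cmeasurableN F : cmeasurable F -> cmeasurable (fun y => - F y).
Proof.
move=> [rF iF]; split.
- rewrite (_ : (fun y => _) = (fun y => - Re (F y))).
    exact: measurable_funN.
  by apply/funext => y; case: (F y).
- rewrite (_ : (fun y => _) = (fun y => - Im (F y))).
    exact: measurable_funN.
  by apply/funext => y; case: (F y).
Qed.

Lemma cmeasurableD F G : cmeasurable F -> cmeasurable G ->
  cmeasurable (fun y => F y + G y).
Proof.
move=> [rF iF] [rG iG]; split.
- rewrite (_ : (fun y => _) = (fun y => Re (F y) + Re (G y))).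
    exact: measurable_funD.
  by apply/funext => y; case: (F y); case: (G y).
- rewrite (_ : (fun y => _) = (fun y => Im (F y) + Im (G y))).
    exact: measurable_funD.
  by apply/funext => y; case: (F y); case: (G y).
Qed.

Lemma cmeasurableM F G : cmeasurable F -> cmeasurable G ->
  cmeasurable (fun y => F y * G y).
Proof.
move=> [rF iF] [rG iG]; split.
- rewrite (_ : (fun y => _) =
      (fun y => Re (F y) * Re (G y) - Im (F y) * Im (G y))).
    by apply: measurable_funB; exact: measurable_funM.
  by apply/funext => y; case: (F y); case: (G y).
- rewrite (_ : (fun y => _) =
      (fun y => Re (F y) * Im (G y) + Im (F y) * Re (G y))).
    by apply: measurable_funD; exact: measurable_funM.
  by apply/funext => y; case: (F y); case: (G y).
Qed.

Lemma cmeasurable_conjc F : cmeasurable F -> cmeasurable (fun y => conjc (F y)).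
Proof.
move=> [rF iF]; split.
- by rewrite (_ : (fun y => _) = (fun y => Re (F y)))//;
    apply/funext => y; case: (F y).
- rewrite (_ : (fun y => _) = (fun y => - Im (F y))).
    exact: measurable_funN.
  by apply/funext => y; case: (F y).
Qed.

Lemma cmeasurableV F : cmeasurable F -> cmeasurable (fun y => (F y)^-1).
Proof.
move=> [rF iF].
have mN : measurable_fun setT
    (fun y => (Re (F y) ^+ 2 + Im (F y) ^+ 2)^-1 : R).
  by apply: measurable_fun_inv; apply: measurable_funD; exact: measurable_funX.
split.
- rewrite (_ : (fun y => _) =
      (fun y => Re (F y) * (Re (F y) ^+ 2 + Im (F y) ^+ 2)^-1)).
    exact: measurable_funM.
  by apply/funext => y; case: (F y).
- rewrite (_ : (fun y => _) =
      (fun y => - (Im (F y) * (Re (F y) ^+ 2 + Im (F y) ^+ 2)^-1))).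
    by apply: measurable_funN; exact: measurable_funM.
  by apply/funext => y; case: (F y) => a b /=; rewrite ?mulNr.
Qed.

(** Sums, complex multiples and conjugation of kernels all act on real and imaginary parts by
    combinations of this form, which are needed only where w is nonzero. *)
Let integrable_lin (f g h : R * R -> R) (a b : R) :
  leb2.-integrable setT (EFin \o (fun y => w y * f y)) ->
  leb2.-integrable setT (EFin \o (fun y => w y * g y)) ->
  (forall y, w y != 0 -> h y = a * f y + b * g y) ->
  leb2.-integrable setT (EFin \o (fun y => w y * h y)).
Proof.
move=> fi gi hE.
rewrite (_ : EFin \o _ = (fun y => a%:E * (w y * f y)%R%:E
    + b%:E * (w y * g y)%R%:E)%E); last first.
  apply/funext => y /=; have [->|w0] := eqVneq (w y) 0.
    by rewrite !mul0r !mule0 adde0.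
  by rewrite hE// -!EFinM -EFinD; congr EFin; ring.
by apply: integrableD => //; apply: integrableZl.
Qed.

Let Rintegral_lin (f g h : R * R -> R) (a b : R) :
  leb2.-integrable setT (EFin \o (fun y => w y * f y)) ->
  leb2.-integrable setT (EFin \o (fun y => w y * g y)) ->
  (forall y, w y != 0 -> h y = a * f y + b * g y) ->
  \int[leb2]_y (w y * h y) =
  a * \int[leb2]_y (w y * f y) + b * \int[leb2]_y (w y * g y).
Proof.
move=> fi gi hE.
transitivity (\int[leb2]_y (a * (w y * f y) + b * (w y * g y))).
  apply: eq_Rintegral => y _; have [->|w0] := eqVneq (w y) 0.
    by rewrite !mul0r !mulr0 addr0.
  by rewrite hE//; ring.
rewrite RintegralD//.
- by rewrite !RintegralZl.
- rewrite (_ : EFin \o _ = (fun y => a%:E * (w y * f y)%R%:E)%E)//.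
  exact: integrableZl.
- rewrite (_ : EFin \o _ = (fun y => b%:E * (w y * g y)%R%:E)%E)//.
  exact: integrableZl.
Qed.

Lemma eq_superpose F G : (forall y, w y != 0 -> F y = G y) ->
  superpose F = superpose G.
Proof.
move=> FG; rewrite /superpose; congr (_ +i* _); apply: eq_Rintegral => y _;
  by have [->|/FG ->//] := eqVneq (w y) 0; rewrite !mul0r.
Qed.

Lemma superposableD F G : superposable F -> superposable G ->
  superposable (fun y => F y + G y).
Proof.
move=> [rF iF] [rG iG]; split.
- apply: (integrable_lin (a := 1) (b := 1) rF rG) => y _.
  by rewrite !mul1r; case: (F y); case: (G y).
- apply: (integrable_lin (a := 1) (b := 1) iF iG) => y _.
  by rewrite !mul1r; case: (F y); case: (G y).
Qed.

Lemma superposeD F G : superposable F -> superposable G ->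
  superpose (fun y => F y + G y) = superpose F + superpose G.
Proof.
move=> [rF iF] [rG iG]; apply/eqP; rewrite eq_complex /=; apply/andP; split; apply/eqP.
- rewrite (Rintegral_lin (a := 1) (b := 1) rF rG) ?mul1r// => y _.
  by rewrite !mul1r; case: (F y); case: (G y).
- rewrite (Rintegral_lin (a := 1) (b := 1) iF iG) ?mul1r// => y _.
  by rewrite !mul1r; case: (F y); case: (G y).
Qed.

Lemma superposableZ c F : superposable F -> superposable (fun y => c * F y).
Proof.
move=> [rF iF]; split.
- apply: (integrable_lin (a := Re c) (b := - Im c) rF iF) => y _.
  by case: c (F y) => a b [u v] /=; ring.
- apply: (integrable_lin (a := Im c) (b := Re c) rF iF) => y _.
  by case: c (F y) => a b [u v] /=; ring.
Qed.

Lemma superposeZ c F : superposable F ->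
  superpose (fun y => c * F y) = c * superpose F.
Proof.
move=> [rF iF]; apply/eqP; rewrite eq_complex; apply/andP; split; apply/eqP.
- rewrite [LHS]/= (Rintegral_lin (a := Re c) (b := - Im c) rF iF).
    by rewrite /superpose; case: c => a b /=; ring.
  by move=> y _; case: c (F y) => a b [u v] /=; ring.
- rewrite [LHS]/= (Rintegral_lin (a := Im c) (b := Re c) rF iF).
    by rewrite /superpose; case: c => a b /=; ring.
  by move=> y _; case: c (F y) => a b [u v] /=; ring.
Qed.

Lemma superposable_conjc F : superposable F ->
  superposable (fun y => conjc (F y)).
Proof.
move=> [rF iF]; split.
- apply: (integrable_lin (a := 1) (b := 0) rF iF) => y _.
  by case: (F y) => a b /=; ring.
- apply: (integrable_lin (a := 0) (b := -1) rF iF) => y _.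
  by case: (F y) => a b /=; ring.
Qed.

Lemma superpose_conjc F : superposable F ->
  superpose (fun y => conjc (F y)) = conjc (superpose F).
Proof.
move=> [rF iF]; apply/eqP; rewrite eq_complex /=; apply/andP; split; apply/eqP.
- rewrite (Rintegral_lin (a := 1) (b := 0) rF iF); first by ring.
  by move=> y _; case: (F y) => a b /=; ring.
- rewrite (Rintegral_lin (a := 0) (b := -1) rF iF); first by ring.
  by move=> y _; case: (F y) => a b /=; ring.
Qed.

Lemma superposable0 : superposable (fun=> 0).
Proof.
by split; rewrite (_ : EFin \o _ = cst 0%E) ?integrable0//;
  apply/funext => y /=; rewrite mulr0.
Qed.

Lemma superpose0 : superpose (fun=> 0) = 0.
Proof.
rewrite -[RHS](mul0r (superpose (fun=> 0))) -(superposeZ _ superposable0).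
by apply: eq_superpose => y _; rewrite mul0r.
Qed.

Let superposable_superpose_sum n (c : 'I_n -> R[i]) (F : 'I_n -> R * R -> R[i]) :
  (forall j, superposable (F j)) ->
  superposable (fun y => \sum_j c j * F j y) /\
  superpose (fun y => \sum_j c j * F j y) = \sum_j c j * superpose (F j).
Proof.
elim: n c F => [|n IH] c F aF.
  rewrite big_ord0 (_ : (fun y => _) = (fun=> 0)); last first.
    by apply/funext => y; rewrite big_ord0.
  by split; [exact: superposable0|exact: superpose0].
have [a s] := IH (fun j => c (widen_ord (leqnSn n) j))
  (fun j => F (widen_ord (leqnSn n) j)) (fun j => aF _).
rewrite (_ : (fun y => _) = (fun y => \sum_(j < n) c (widen_ord (leqnSn n) j)
    * F (widen_ord (leqnSn n) j) y + c ord_max * F ord_max y)); last first.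
  by apply/funext => y; rewrite big_ord_recr.
have aM : superposable (fun y => c ord_max * F ord_max y).
  exact: superposableZ.
split; first exact: superposableD.
by rewrite superposeD// s superposeZ// big_ord_recr.
Qed.

Lemma superposable_sum n (c : 'I_n -> R[i]) (F : 'I_n -> R * R -> R[i]) :
  (forall j, superposable (F j)) -> superposable (fun y => \sum_j c j * F j y).
Proof. by move=> /superposable_superpose_sum - /(_ c)[]. Qed.

Lemma superpose_sum n (c : 'I_n -> R[i]) (F : 'I_n -> R * R -> R[i]) :
  (forall j, superposable (F j)) ->
  superpose (fun y => \sum_j c j * F j y) = \sum_j c j * superpose (F j).
Proof. by move=> /superposable_superpose_sum - /(_ c)[]. Qed.

(** The factor 2 is the price of bounding the real and imaginary parts separately; only the
    existence of a constant matters in the end. *)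
Lemma superpose_le F b s M L : 0 <= L -> source_bounds w s M L ->
  superposable F -> (forall y, w y != 0 -> Normc.normc (F y) <= b) ->
  Normc.normc (superpose F) <= 2 * b * \int[leb2]_y `|w y|.
Proof.
move=> L0 ws [rF iF] Fb.
have nw : leb2.-integrable setT (EFin \o (fun y => `|w y|)).
  have [mw _ _ _] := ws.
  have := @integrable_source_bounded _ w s M L (cst 1) 1 L0 ws (measurable_cst _).
  move=> /(_ _)/integrable_norm h; apply: eq_integrable (h _) => //=.
    by move=> y _; rewrite /= mulr1.
  by move=> y _; rewrite normr1.
have le1 (f : R * R -> R) :
    leb2.-integrable setT (EFin \o (fun y => w y * f y)) ->
    (forall y, w y != 0 -> `|f y| <= b) ->
    `|\int[leb2]_y (w y * f y)| <= b * \int[leb2]_y `|w y|.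
  move=> fi fb; apply: le_trans (le_normr_Rintegral _ fi) _ => //.
  rewrite -RintegralZl//; apply: le_Rintegral => //.
  - exact: integrable_norm.
  - rewrite (_ : EFin \o _ = (fun y => b%:E * (`|w y|)%R%:E)%E)//.
    exact: integrableZl.
  - move=> y _; have [->|w0] := eqVneq (w y) 0.
      by rewrite mul0r normr0 mulr0.
    by rewrite normrM mulrC ler_wpM2r// fb.
apply: le_trans (normc_le_ReIm _) _; rewrite -mulrA [2 * _]mulrDl mul1r lerD//=.
  by apply: le1 => // y w0; apply: le_trans (le_normc_Re _) (Fb y w0).
by apply: le1 => // y w0; apply: le_trans (le_normc_Im _) (Fb y w0).
Qed.

Lemma superposable_bounded F b s M L : 0 <= L -> source_bounds w s M L ->
  cmeasurable F -> (forall y, w y != 0 -> Normc.normc (F y) <= b) ->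
  superposable F.
Proof.
move=> L0 ws [rF iF] Fb; split; apply: (integrable_source_bounded L0 ws) => //.
  by move=> y w0; apply: le_trans (le_normc_Re _) (Fb y w0).
by move=> y w0; apply: le_trans (le_normc_Im _) (Fb y w0).
Qed.

Lemma superposable_singular x s M L : 0 <= L -> source_bounds w s M L ->
  superposable (fun y => (toC x - toC y)^-1).
Proof.
move=> L0 ws.
have [rF iF] : cmeasurable (fun y => (toC x - toC y)^-1).
  apply: cmeasurableV; apply: cmeasurableD; first exact: cmeasurable_cst.
  by apply: cmeasurableN; exact: cmeasurable_toC.
have Fle y : Normc.normc ((toC x - toC y)^-1) <= `|x - y|^-1.
  rewrite Normc.normcV -toCB normc_toC.
  have [->|xy] := eqVneq x y.
    by rewrite subrr normr0 invr0 /enorm /dot/= mulr0 addr0 sqrtr0 invr0.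
  have n0 : 0 < `|x - y| by rewrite normr_gt0 subr_eq0.
  by rewrite lef_pV2 ?posrE ?norm_le_enorm// (lt_le_trans n0)// norm_le_enorm.
split; apply: (integrable_source_singular (x := x) L0 ws) => // y.
  exact: le_trans (le_normc_Re _) (Fle y).
exact: le_trans (le_normc_Im _) (Fle y).
Qed.

(** [perp] is multiplication by 'i, which conjugation turns into -'i; the domain extends to the
    whole plane because w vanishes outside [D]. *)
Lemma conjc_vintegral D (k : R * R -> R * R) :
  (forall y, w y != 0 -> D y) ->
  conjc (toC (vintegral D (fun y => w y *: perp (k y)))) =
  - 'i * superpose (fun y => conjc (toC (k y))).
Proof.
move=> wD; have extend (f : R * R -> R) :
    \int[leb2]_(y in D) (w y * f y) = \int[leb2]_y (w y * f y).
  rewrite Rintegral_mkcond; apply: eq_Rintegral => y _; rewrite patchE.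
  case: ifPn => // yD; have [->|/wD wy] := eqVneq (w y) 0; first by rewrite mul0r.
  by rewrite (mem_set wy) in yD.
have e1 : (vintegral D (fun y => w y *: perp (k y))).1 =
    \int[leb2]_y (w y * Im (conjc (toC (k y)))).
  exact: (extend (fun y => - (k y).2)).
have e2 : (vintegral D (fun y => w y *: perp (k y))).2 =
    \int[leb2]_y (w y * Re (conjc (toC (k y)))).
  exact: (extend (fun y => (k y).1)).
rewrite /toC e1 e2 /superpose; apply/eqP; rewrite eq_complex/=.
by apply/andP; split; apply/eqP; ring.
Qed.

Lemma conjc_plane_velocity x :
  conjc (toC (plane_velocity w x)) =
  - 'i * ((2 * pi)^-1)%:C * superpose (fun y => (toC x - toC y)^-1).
Proof.
rewrite /plane_velocity toCZ conjcM conjc_real conjc_vintegral//.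
rewrite mulrCA mulrA; congr (_ * _); apply: eq_superpose => y _.
by rewrite conjc_toC_inversion toCB.
Qed.

Lemma superpose1 : superpose (fun=> 1) = (\int[leb2]_y w y)%:C.
Proof.
rewrite /superpose; congr (_ +i* _).
  by apply: eq_Rintegral => y _; rewrite mulr1.
rewrite (_ : (fun y => _) = cst 0); last by apply/funext => y; rewrite mulr0.
by rewrite /Rintegral integral0.
Qed.

Lemma conjc_exterior_velocity gamma x : (forall y, w y != 0 -> Omega y) ->
  conjc (toC (exterior_velocity w gamma x)) =
  - 'i * ((2 * pi)^-1)%:C * (superpose (fun y => (toC x - toC y)^-1
      - (toC x - (conjc (toC y))^-1)^-1)
    + (gamma%:C + superpose (fun=> 1)) / toC x).
Proof.
move=> wO.
have -> : toC (exterior_velocity w gamma x) = ((2 * pi)^-1)%:C *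
    toC (vintegral Omega (fun y =>
      w y *: perp (inversion (x - y) - inversion (x - inversion y)))) +
    ((2 * pi)^-1 * (gamma + \int[leb2]_(y in Omega) w y))%:C *
      ('i * toC (inversion x)).
  by rewrite -toCZ -toC_perp -toCZ.
have -> : \int[leb2]_(y in Omega) w y = \int[leb2]_y w y.
  rewrite Rintegral_mkcond; apply: eq_Rintegral => y _; rewrite patchE.
  case: ifPn => // yO; have [->//|/wO wy] := eqVneq (w y) 0.
  by rewrite (mem_set wy) in yO.
rewrite conjcD !conjcM !conjc_real conjc_vintegral// conjc_i.
rewrite conjc_toC_inversion superpose1.
have -> : superpose (fun y => conjc (toC
      (inversion (x - y) - inversion (x - inversion y)))) =
    superpose (fun y => (toC x - toC y)^-1 - (toC x - (conjc (toC y))^-1)^-1).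
  apply: eq_superpose => y _.
  by rewrite toCB conjcB !conjc_toC_inversion !toCB toC_inversion.
rewrite rmorphM rmorphD/=; ring.
Qed.


End superposition.

(** * A single source *)

Section pointwise.
Local Open Scope complex_scope.
Context {R : realType} (s : R) (n : nat).
Hypothesis s_gt1 : 1 < s.
Local Notation N := n.+1.
Local Notation nr := (@Normc.normc R).
Local Notation zeta := (fun j : 'I_N => toC (vortex j : R * R)).
Local Notation xi := (fun i : 'I_N => toC (midpoint i : R * R)).

Let s_gt0 : 0 < s. Proof. exact: lt_trans s_gt1. Qed.

Let N0 : N%:R != 0 :> R[i]. Proof. by rewrite pnatr_eq0. Qed.

Let s1 : 0 < s - 1. Proof. by rewrite subr_gt0. Qed.

Lemma far_inv z : s <= nr z -> nr z^-1 <= 1.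
Proof.
move=> sz; have z0 : 0 < nr z by exact: lt_le_trans sz.
by rewrite Normc.normcV invf_le1// (le_trans _ sz)// ltW.
Qed.

(** Bounds 1 / |z^N - 1| whenever s <= |z|; every quadrature error below is measured in it. *)
Definition err : R := (s ^+ N - 1)^-1.

Lemma sN_gt1 : 1 < s ^+ N.
Proof. by rewrite exprn_egt1. Qed.

Lemma err_gt0 : 0 < err.
Proof. by rewrite invr_gt0 subr_gt0 sN_gt1. Qed.

Lemma far_expN1 z : s <= nr z -> s ^+ N - 1 <= nr (z ^+ N - 1).
Proof.
move=> sz; apply: le_trans (lerB_normcB _ _).
by rewrite normcX Normc.normc1 lerB// lerXn2r// nnegrE ?(ltW s_gt0)// normc_ge0.
Qed.

Lemma far_expN_neq1 z : s <= nr z -> z ^+ N != 1.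
Proof.
move=> sz; rewrite -subr_eq0 -normc_eq0 gt_eqF//.
by apply: lt_le_trans (far_expN1 sz); rewrite subr_gt0 sN_gt1.
Qed.

Lemma far_err z : s <= nr z -> nr (z ^+ N - 1)^-1 <= err.
Proof.
move=> sz; have h := far_expN1 sz; have s0 : 0 < s ^+ N - 1.
  by rewrite subr_gt0 sN_gt1.
by rewrite Normc.normcV lef_pV2// posrE// (lt_le_trans s0).
Qed.

(** For k <= N the quotient a^k / (a^N - 1) decreases in a > 1; after cross-multiplication this
    reduces to s^k <= a^k and s^(N-k) <= a^(N-k). *)
Lemma far_power z k : s <= nr z -> (k <= N)%N ->
  nr (z ^+ k / (z ^+ N - 1)) <= s ^+ k * err.
Proof.
move=> sz kN; rewrite Normc.normcM normcX Normc.normcV.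
set a := nr z in sz *.
have a1 : 1 < a by exact: lt_le_trans sz.
have aN : 0 < a ^+ N - 1 by rewrite subr_gt0 exprn_egt1.
have le1 : a ^+ N - 1 <= nr (z ^+ N - 1).
  by apply: le_trans (lerB_normcB _ _); rewrite normcX Normc.normc1.
apply: le_trans (_ : a ^+ k / (a ^+ N - 1) <= _).
  rewrite ler_wpM2l ?exprn_ge0 ?(ltW (lt_trans _ a1))//.
  by rewrite lef_pV2// posrE// (lt_le_trans aN).
rewrite ler_pdivrMr// /err mulrAC ler_pdivlMr ?subr_gt0 ?sN_gt1//.
have sak m : s ^+ m <= a ^+ m by rewrite lerXn2r// nnegrE ltW// (lt_trans _ a1).
rewrite -(subnKC kN) !exprD.
have := sak k; have := sak (N - k)%N.
have : 0 < s ^+ k by rewrite exprn_gt0.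
have : 0 < a ^+ k by rewrite exprn_gt0// (lt_trans _ a1).
move: (s ^+ k) (a ^+ k) (s ^+ (N - k)) (a ^+ (N - k)) => p r t v r0 p0 tv pr.
have : p * r * t <= p * r * v by rewrite ler_wpM2l// mulr_ge0// ltW.
lra.
Qed.

Lemma far_from_circle z v : s <= nr z -> nr v <= 1 -> s - 1 <= nr (z - v).
Proof. by move=> sz v1; apply: le_trans (lerB_normcB _ _); rewrite lerB. Qed.

Lemma far_from_circle_inv z v : s <= nr z -> nr v <= 1 ->
  nr (z - v)^-1 <= (s - 1)^-1.
Proof.
move=> sz v1; have h := far_from_circle sz v1.
by rewrite Normc.normcV lef_pV2// posrE// (lt_le_trans s1).
Qed.

Lemma far_from_circle_neq0 z v : s <= nr z -> nr v <= 1 -> z - v != 0.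
Proof.
move=> sz v1; rewrite -normc_eq0 gt_eqF//.
exact: lt_le_trans (far_from_circle sz v1).
Qed.

Let nz j : nr (zeta j) <= 1. Proof. by rewrite normc_vortex. Qed.
Let nx j : nr (xi j) <= 1. Proof. by rewrite normc_midpoint. Qed.

Let zN (j : 'I_N) : zeta j ^+ N = 1. Proof. exact: vortexN. Qed.
Let xN (j : 'I_N) : xi j ^+ N = -1. Proof. exact: midpointN. Qed.
Let sumz m : (0 < m < N)%N -> \sum_j zeta j ^+ m = 0.
Proof. exact: sum_vortexX. Qed.

(** Half of the sheet strength for a unit source at e. The other half is the conjugate, equal to u /
    (u - [zeta j]) with u = 1 / conj e the image of e in the circle. *)
Definition trial (j : 'I_N) (e : R[i]) : R[i] := zeta j / (zeta j - e).

Lemma trialE j e : trial j e = - (zeta j / (e - zeta j)).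
Proof. by rewrite /trial -opprB invrN mulrN. Qed.

Lemma trial_le j e : s <= nr e -> nr (trial j e) <= (s - 1)^-1.
Proof.
move=> se; rewrite trialE normcN Normc.normcM normc_vortex mul1r.
exact: far_from_circle_inv.
Qed.

(** Since e lies outside the disk, z / (z - e) has mean zero over the circle: the sum is pure
    quadrature error. *)
Lemma sum_trial e : s <= nr e ->
  \sum_j trial j e = - N%:R * (e ^+ N - 1)^-1.
Proof.
move=> se; under eq_bigr do rewrite trialE -[X in X / _]expr1.
by rewrite sumrN (sum_root_moment zN)// ?far_expN_neq1// expr0 mulr1 mul1r mulNr.
Qed.

(** Partial fractions separate the pole [xi i] from the pole e. At a midpoint z^N = -1, so 1 / (z^N
    - 1) is exactly -1/2: the singular pole yields the term subtracted on the left without any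
    error, and what remains carries the factor 1 / (e^N - 1). *)
Lemma tangency_trial i e : s <= nr e ->
  \sum_j (tangency_kernel i j)%:C * trial j e - N%:R * ('i / 2 * (xi i / (xi i - e)))
  = N%:R * 'i * ((e ^+ N - 1)^-1 * (xi i / (xi i - e) - 2^-1)).
Proof.
move=> se; have i0 : 'i != 0 :> R[i] by rewrite eq_complex/= oner_eq0 andbF.
have two0 : 2 != 0 :> R[i] by rewrite pnatr_eq0.
have e1 : e ^+ N - 1 != 0 by rewrite subr_eq0 far_expN_neq1.
have xe : xi i - e != 0.
  by rewrite -opprB oppr_eq0 far_from_circle_neq0.
have x1 : xi i ^+ N != 1.
  by rewrite xN -subr_eq0 -opprD oppr_eq0.
have S : \sum_j trial j e / (xi i - zeta j) =
    N%:R / (xi i - e) * (- 2^-1 - (e ^+ N - 1)^-1).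
  transitivity (\sum_j (xi i - e)^-1 *
     (zeta j ^+ 1 / (xi i - zeta j) - zeta j ^+ 1 / (e - zeta j))).
    apply: eq_bigr => j _; rewrite trialE expr1.
    have d1 : e - zeta j != 0 by exact: far_from_circle_neq0.
    have d2 : xi i - zeta j != 0 by exact: midpoint_neq_vortex.
    by field; rewrite d1 d2 xe.
  rewrite -mulr_sumr sumrB (sum_root_moment zN sumz isT x1 (ltn0Sn n)).
  rewrite (sum_root_moment zN sumz isT (far_expN_neq1 se) (ltn0Sn n)).
  rewrite !expr0 xN; have -> : -1 - 1 = - 2 :> R[i] by ring.
  by field; rewrite ?oppr_eq0 ?e1 ?xe ?two0.
apply: (mulfI i0); rewrite mulrBr mulr_sumr.
transitivity (xi i * (\sum_j trial j e / (xi i - zeta j))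
    - 2^-1 * (\sum_j trial j e) - 'i * (N%:R * ('i / 2 * (xi i / (xi i - e))))).
  congr (_ - _); rewrite !mulr_sumr -sumrB; apply: eq_bigr => j _.
  have kE : 'i * (tangency_kernel i j)%:C = cot_kernel zeta xi i j.
    exact: tangency_kernelE.
  by rewrite [LHS]mulrA kE /cot_kernel; ring.
rewrite S sum_trial//.
have i2 : 'i * 'i = -1 :> R[i] by rewrite -expr2 sqr_i.
have -> : 'i * (N%:R * ('i / 2 * (xi i / (xi i - e)))) =
    - (N%:R / 2 * (xi i / (xi i - e))).
  transitivity (('i * 'i) * (N%:R / 2 * (xi i / (xi i - e)))); first by ring.
  by rewrite i2 mulN1r.
transitivity (('i * 'i) * (N%:R * ((e ^+ N - 1)^-1 * (xi i / (xi i - e) - 2^-1)))).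
  rewrite i2; by field; rewrite ?e1 ?xe ?two0.
by rewrite -mulrA; congr (_ * _); rewrite mulrCA mulrA.
Qed.

Lemma tangency_trial_le i e : s <= nr e ->
  nr (\sum_j (tangency_kernel i j)%:C * trial j e
      - N%:R * ('i / 2 * (xi i / (xi i - e))))
  <= N%:R * err * ((s - 1)^-1 + 1).
Proof.
move=> se; rewrite tangency_trial//.
have ni : nr 'i = 1 by rewrite /= expr0n/= add0r expr1n sqrtr1.
have nN : nr N%:R = N%:R by rewrite -(rmorph_nat (real_complex R)) normc_real ger0_norm.
rewrite 3!Normc.normcM nN ni mulr1 -mulrA ler_wpM2l// ler_pM ?normc_ge0//.
  exact: far_err.
apply: le_trans (le_normcB _ _) _; apply: lerD.
  rewrite Normc.normcM normc_midpoint mul1r -opprB invrN normcN.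
  exact: far_from_circle_inv.
have -> : (2^-1 : R[i]) = (2^-1)%:C by rewrite fmorphV rmorph_nat.
by rewrite normc_real ger0_norm// invf_le1// ler1n.
Qed.

(** Compares the image field, a vortex at the origin minus one at u = 1 / conj e, with the
    quadrature of the sheet. The half [trial j e] goes through [sum_unity_root_pair], since z = e is
    possible; the conjugate half has its pole at u, inside the disk, so dividing by z - u is
    harmless. *)
Lemma exterior_trial z e : s <= nr z -> s <= nr e ->
  z^-1 - (z - (conjc e)^-1)^-1
      - N%:R^-1 * \sum_j (trial j e + conjc (trial j e)) / (z - zeta j)
  = \sum_(k < N) (z ^+ (N.-1 - k) / (z ^+ N - 1)) * (e ^+ k / (e ^+ N - 1))
    + (z - (conjc e)^-1)^-1 * ((conjc e)^-1 / z * (z ^+ N - 1)^-1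
        + (conjc e ^+ N - 1)^-1).
Proof.
move=> sz se; set f := conjc e; have sf : s <= nr f by rewrite normc_conjc.
have f1 := far_expN_neq1 sf; have z1 := far_expN_neq1 sz.
have e1 := far_expN_neq1 se.
have f0 : f != 0 by rewrite -[f]subr0 far_from_circle_neq0// Normc.normc0.
have z0 : z != 0 by rewrite -[z]subr0 far_from_circle_neq0// Normc.normc0.
set u := f^-1.
have u1 : nr u <= 1.
  exact: far_inv.
have zu : z - u != 0 by exact: far_from_circle_neq0.
have uN : u ^+ N != 1 by rewrite (exprVn f N) (invr_eq1 (f ^+ N)); exact: f1.
have trialC j : conjc (trial j e) = u / (u - zeta j).
  have zj0 : zeta j != 0 by rewrite -normc_eq0 normc_vortex oner_eq0.
  have zC : conjc (zeta j) = (zeta j)^-1 by exact: conjc_cis.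
  rewrite /trial conjcM conjc_inv conjcB zC -/f /u.
  have d1 : f - zeta j != 0 by exact: far_from_circle_neq0.
  have d2 : f^-1 - zeta j != 0 by rewrite (sub_root_neq0 zN).
  have d3 : (zeta j)^-1 - f != 0.
    by rewrite -[f]invrK subr_eq0 (inj_eq invr_inj) eq_sym -subr_eq0.
  by apply: (mulIf d3); rewrite mulfVK//; apply: (mulIf d2);
    rewrite mulrAC mulfVK//; field; rewrite ?f0 ?zj0.
rewrite (eq_bigr (fun j => trial j e / (z - zeta j) +
    u / (z - u) * ((u - zeta j)^-1 - (z - zeta j)^-1))); last first.
  move=> j _; rewrite mulrDl trialC; congr (_ + _).
  have d1 : z - zeta j != 0 by exact: far_from_circle_neq0.
  have d2 : u - zeta j != 0 by rewrite (sub_root_neq0 zN).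
  by field; rewrite ?d1 ?d2 ?zu.
rewrite big_split/= -mulr_sumr sumrB (sum_unity_root_pair zN sumz isT z1 e1).
rewrite (sum_root_inv zN sumz isT z1) (sum_root_inv zN sumz isT uN).
have -> : \sum_(k < N) z ^+ (N.-1 - k) / (z ^+ N - 1) * (e ^+ k / (e ^+ N - 1)) =
    (\sum_(k < N) z ^+ (N.-1 - k) * e ^+ k) / ((z ^+ N - 1) * (e ^+ N - 1)).
  by rewrite mulr_suml; apply: eq_bigr => k _; rewrite invfM; ring.
set S := \sum_(k < N) _.
have {}e1 : e ^+ N - 1 != 0 by rewrite (subr_eq0 (e ^+ N)); exact: e1.
have {}z1 : z ^+ N - 1 != 0 by rewrite (subr_eq0 (z ^+ N)); exact: z1.
have {}f1 : f ^+ N - 1 != 0 by rewrite (subr_eq0 (f ^+ N)); exact: f1.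
have {}uN : u ^+ N - 1 != 0 by rewrite (subr_eq0 (u ^+ N)); exact: uN.
have zE : z ^+ N = z * z ^+ N.-1 by rewrite -exprS.
(* u^N / (u^N - 1) = -1 / (f^N - 1): returning from the image u to f shows that this term is
   small. *)
have uE : u * (N%:R * u ^+ N.-1 / (u ^+ N - 1)) = - N%:R * (f ^+ N - 1)^-1.
  rewrite mulrA mulrCA -exprS /u exprVn; rewrite /u exprVn in uN.
  have fN0 : f ^+ N != 0 by rewrite expf_neq0.
  by apply: (mulIf uN); rewrite mulfVK//; field; rewrite ?f1 ?fN0.
move: uE; set U := N%:R * u ^+ N.-1 / _ => uE.
have UE : u / (z - u) * (U - N%:R * z ^+ N.-1 / (z ^+ N - 1)) =
    (z - u)^-1 * (- N%:R * (f ^+ N - 1)^-1 - u / z * (N%:R * z ^+ N / (z ^+ N - 1))).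
  rewrite -uE zE; rewrite zE in z1; move: (z ^+ N.-1) z1 => p z1.
  by field; rewrite ?zu ?z0 ?z1.
rewrite UE.
move: (z ^+ N) (e ^+ N) (f ^+ N) z1 e1 f1 => p t v z1 e1 f1.
by field; rewrite ?zu ?z0 ?z1 ?e1 ?f1 nat1r N0.
Qed.

Lemma exterior_trial_le z e : s <= nr z -> s <= nr e ->
  nr (z^-1 - (z - (conjc e)^-1)^-1
      - N%:R^-1 * \sum_j (trial j e + conjc (trial j e)) / (z - zeta j))
  <= 2 * err / (s - 1) + N%:R * (s ^+ N * err ^+ 2).
Proof.
move=> sz se; rewrite exterior_trial// addrC.
have sf : s <= nr (conjc e) by rewrite normc_conjc.
have u1 : nr (conjc e)^-1 <= 1.
  exact: far_inv.
apply: le_trans (le_normcD _ _) _; apply: lerD.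
  rewrite Normc.normcM mulrC ler_pM ?normc_ge0//; last exact: far_from_circle_inv.
  apply: le_trans (le_normcD _ _) _; rewrite mulrDl mul1r lerD ?far_err//.
  rewrite 2!Normc.normcM -[leRHS]mul1r ler_pM ?mulr_ge0 ?normc_ge0 ?far_err//.
  by rewrite -[leRHS]mul1r ler_pM ?normc_ge0 ?far_inv.
apply: le_trans (le_normc_sum _ _ _) _.
rewrite mulr_natl -[X in _ *+ X](card_ord N) -sumr_const.
apply: ler_sum => k _; rewrite Normc.normcM.
have kn : (k <= n)%N by rewrite -ltnS.
(* The two exponents add up to n for every k, so all N terms have the same bound. *)
apply: le_trans (_ : (s ^+ (n - k) * err) * (s ^+ k * err) <= _).
  by rewrite ler_pM ?normc_ge0// far_power// ltnW// ltnS leq_subr.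
have -> : s ^+ (n - k) * err * (s ^+ k * err) = s ^+ n * err ^+ 2.
  by rewrite -[in RHS](subnK kn) exprD; ring.
rewrite ler_wpM2r ?exprn_ge0 ?(ltW err_gt0)//.
by rewrite exprS ler_peMl ?exprn_ge0 ?(ltW s_gt0) ?(ltW s_gt1).
Qed.

(** Outside the disk a uniform sheet acts as a vortex at the origin; this accounts for the part of
    the strength equal to gamma. *)
Lemma exterior_uniform z : s <= nr z ->
  z^-1 - N%:R^-1 * \sum_j (z - zeta j)^-1 = - (z^-1 * (z ^+ N - 1)^-1).
Proof.
move=> sz; have z1 : z ^+ N - 1 != 0 by rewrite subr_eq0 far_expN_neq1.
have z0 : z != 0 by rewrite -[z]subr0 far_from_circle_neq0// Normc.normc0.
rewrite (sum_root_inv zN)// ?far_expN_neq1//.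
have zE : z ^+ N = z * z ^+ N.-1 by rewrite -exprS.
by rewrite zE in z1 *; move: (z ^+ N.-1) z1 => p z1; field; rewrite ?nat1r ?N0 z0 z1.
Qed.

End pointwise.

(** * The velocity error *)

Section consistency.
Local Open Scope complex_scope.
Context {R : realType} (w : R * R -> R) (s M L gamma : R) (n : nat).
Hypothesis s_gt1 : 1 < s.
Hypothesis L_ge0 : 0 <= L.
Hypothesis w_src : source_bounds w s M L.
Local Notation N := n.+1.
Local Notation nr := (@Normc.normc R).
Local Notation zeta := (fun j : 'I_N => toC (vortex j : R * R)).
Local Notation xi := (fun i : 'I_N => toC (midpoint i : R * R)).
Local Notation Re := complex.Re.
Local Notation I := (superpose w).
Local Notation err := (err s n).

Definition mass : R := \int[leb2]_y `|w y|.

Lemma mass_ge0 : 0 <= mass.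
Proof. exact: Rintegral_ge0. Qed.

Let N0 : N%:R != 0 :> R. Proof. by rewrite pnatr_eq0. Qed.

Let far y : w y != 0 -> s <= nr (toC y).
Proof. by rewrite normc_toC; have [_ _ h _] := w_src; exact: h. Qed.

Lemma vortex_systemE (g : 'rV[R]_N) : vortex_system w gamma g <->
  (forall i : 'I_N, (i.+1 < N)%N -> \sum_j tangency_kernel i j * g 0 j =
     - (2 * pi * N%:R * dot (plane_velocity w (midpoint i)) (normal (midpoint i))))
  /\ \sum_j g 0 j = N%:R * gamma.
Proof.
have p0 : pi != 0 :> R by rewrite gt_eqF// pi_gt0.
have tE i : (2 * pi)^-1 * \sum_(j < N) g 0 j / N%:R *
    dot (perp (inversion (midpoint i - vortex j))) (normal (midpoint i)) =
    (2 * pi)^-1 * (N%:R^-1 * \sum_j tangency_kernel i j * g 0 j).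
  congr (_ * _); rewrite mulr_sumr; apply: eq_bigr => j _.
  by rewrite /tangency_kernel; ring.
have p2 : 2 * pi != 0 :> R by rewrite mulf_neq0.
split=> [[h1 h2]|[h1 h2]]; split.
- move=> i /h1; rewrite tE => h.
  apply: (mulfI (invr_neq0 N0)); apply: (mulfI (invr_neq0 p2)); rewrite h.
  by move: (@pi R) p0 (dot _ _) => P P0 D; field; rewrite nat1r P0 N0.
- by rewrite -h2 mulr_sumr; apply: eq_bigr => j _; rewrite mulrC divfK.
- move=> i iN; rewrite tE h1//.
  by move: (@pi R) p0 (dot _ _) => P P0 D; field; rewrite nat1r P0 N0.
- by rewrite -mulr_suml h2 mulrAC mulfV// mul1r.
Qed.

Let cm_sub (c : R[i]) : cmeasurable (fun y => (c - toC y)^-1).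
Proof.
apply: cmeasurableV; apply: cmeasurableD; first exact: cmeasurable_cst.
by apply: cmeasurableN; exact: cmeasurable_toC.
Qed.

Let sp_trial (j : 'I_N) : superposable w (fun y => trial j (toC y)).
Proof.
apply: (superposable_bounded L_ge0 w_src (b := (s - 1)^-1)).
  by apply: cmeasurableM; [exact: cmeasurable_cst|exact: cm_sub].
by move=> y /far; exact: trial_le.
Qed.

Let sp_kernel (i : 'I_N) : superposable w (fun y => (xi i - toC y)^-1).
Proof. exact: superposable_singular L_ge0 w_src. Qed.

Definition trial_coef (j : 'I_N) : R[i] := I (fun y => trial j (toC y)).

Arguments trial_coef : simpl never.

(* Up to normalisation, the tangential velocity of the full-plane field at the
   vortices: the strength of the vortex sheet that [N] point vortices sample. *)
Definition trial_strength (j : 'I_N) : R := gamma + 2 * Re (trial_coef j).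

Lemma sum_trial_coef (c : 'I_N -> R[i]) :
  \sum_j c j * trial_coef j = I (fun y => \sum_j c j * trial j (toC y)).
Proof. by rewrite superpose_sum. Qed.

Lemma trial_mean : `|(\sum_j trial_strength j) / N%:R - gamma| <= 4 * err * mass.
Proof.
have -> : (\sum_j trial_strength j) / N%:R - gamma =
    2 * Re (\sum_j 1 * trial_coef j) / N%:R.
  rewrite /trial_strength big_split/= sumr_const card_ord -[gamma *+ _]mulr_natl.
  rewrite -mulr_sumr.
  rewrite Re_sum; under [in RHS]eq_bigr do rewrite mul1r.
  by field; rewrite nat1r.
rewrite !normrM normfV (ger0_norm (ler0n _ 2)) (ger0_norm (ler0n _ N)).
rewrite ler_pdivrMr ?ltr0n//.
have le1 : nr (\sum_j 1 * trial_coef j) <= 2 * (N%:R * err) * mass.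
  rewrite sum_trial_coef; apply: (superpose_le L_ge0 w_src).
    exact: superposable_sum.
  move=> y /far sy; under eq_bigr do rewrite mul1r.
  rewrite (sum_trial n s_gt1 sy) Normc.normcM normcN -(rmorph_nat (real_complex R)).
  by rewrite normc_real ger0_norm// ler_wpM2l// far_err.
apply: le_trans (_ : 2 * (2 * (N%:R * err) * mass) <= _); last by lra.
by rewrite ler_wpM2l//; apply: le_trans (le_normc_Re _) le1.
Qed.

Lemma plane_velocity_normal (i : 'I_N) :
  2 * pi * dot (plane_velocity w (midpoint i)) (normal (midpoint i)) =
  - (2 * Re ('i / 2 * (xi i * I (fun y => (xi i - toC y)^-1)))).
Proof.
have p0 : 2 * pi != 0 :> R by rewrite mulf_neq0// gt_eqF// pi_gt0.
rewrite dotE conjc_plane_velocity /normal.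
set J := I _; set c := (2 * pi)^-1.
have -> : - 'i * c%:C * J * toC (midpoint i) =
    (- (2 * c))%:C * ('i / 2 * (toC (midpoint i) * J)).
  rewrite rmorphN rmorphM/= rmorph_nat.
  by move: (c%:C) J (toC _) => C0 J0 X; field.
have scale (P : R) (z : R[i]) : 2 * P != 0 ->
    2 * P * Re ((- (2 * (2 * P)^-1))%:C * z) = - (2 * Re z).
  by move=> P0; rewrite ReMreal; field; move: P0; rewrite mulf_eq0 negb_or => /andP[].
exact: scale.
Qed.

Lemma trial_tangency (i : 'I_N) :
  `|\sum_j tangency_kernel i j * trial_strength j +
    2 * pi * N%:R * dot (plane_velocity w (midpoint i)) (normal (midpoint i))|
  <= 4 * (N%:R * err) * ((s - 1)^-1 + 1) * mass.
Proof.
pose F y := \sum_j (tangency_kernel i j)%:C * trial j (toC y)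
  + - (N%:R * ('i / 2 * xi i)) * (xi i - toC y)^-1.
have spS : superposable w (fun y => \sum_j (tangency_kernel i j)%:C * trial j (toC y)).
  exact: superposable_sum.
have spK : superposable w (fun y => - (N%:R * ('i / 2 * xi i)) * (xi i - toC y)^-1).
  exact: superposableZ.
have spF : superposable w F by exact: superposableD.
have -> : \sum_j tangency_kernel i j * trial_strength j +
    2 * pi * N%:R * dot (plane_velocity w (midpoint i)) (normal (midpoint i))
    = 2 * Re (I F).
  rewrite /F superposeD// superposeZ// -sum_trial_coef.
  rewrite (mulrAC _ N%:R) plane_velocity_normal.
  set J := I _.
  have -> : \sum_j tangency_kernel i j * trial_strength j =
      2 * Re (\sum_j (tangency_kernel i j)%:C * trial_coef j).
    under eq_bigr do rewrite mulrDr.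
    (* The constant gamma induces no normal velocity at the midpoints, because the rows of the
       kernel sum to zero. *)
    rewrite big_split/= -mulr_suml tangency_kernel_row mul0r add0r.
    rewrite Re_sum mulr_sumr; apply: eq_bigr => j _.
    by rewrite ReMreal mulrCA.
  have -> : - (N%:R * ('i / 2 * xi i)) * J = (- N%:R)%:C * ('i / 2 * (xi i * J)).
    by rewrite rmorphN rmorph_nat !mulNr -!mulrA.
  by rewrite ReD ReMreal; ring.
have le1 : nr (I F) <= 2 * (N%:R * err * ((s - 1)^-1 + 1)) * mass.
  apply: (superpose_le L_ge0 w_src) => // y /far sy.
  apply: le_trans (tangency_trial_le s_gt1 i sy); rewrite /F.
  by rewrite le_eqVlt; apply/orP; left; apply/eqP; congr nr; ring.
rewrite normrM (ger0_norm (ler0n _ 2)).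
apply: le_trans (_ : 2 * (2 * (N%:R * err * ((s - 1)^-1 + 1)) * mass) <= _).
  by rewrite ler_wpM2l//; apply: le_trans (le_normc_Re _) le1.
lra.
Qed.

(** Stability is applied to the difference of the two strengths: its mean is controlled by
    [trial_mean] and its normal velocities by [trial_tangency], which give the two terms of the
    bound. *)
Lemma strength_error (g : 'rV[R]_N) j : vortex_system w gamma g ->
  `|g 0 j - trial_strength j| <=
  4 * err * mass + 4 * (4 * (N%:R * err) * ((s - 1)^-1 + 1) * mass).
Proof.
move=> /vortex_systemE[gt gs].
have e0 : 0 < err by exact: err_gt0.
have m0 := mass_ge0.
have s1 : 0 <= (s - 1)^-1 by rewrite invr_ge0 subr_ge0 ltW.
have := tangency_stability (g := fun j => g 0 j - trial_strength j)
  (b := 4 * (N%:R * err) * ((s - 1)^-1 + 1) * mass) j.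
move=> /(_ _ _)/le_trans; apply.
- by rewrite !mulr_ge0 ?ler0n ?(ltW e0)// addr_ge0.
- move=> i iN; under eq_bigr do rewrite mulrBr.
  by rewrite sumrB gt// -normrN opprB opprK; exact: trial_tangency.
- rewrite lerD2r sumrB gs mulrBl mulrAC mulfV// mul1r distrC.
  exact: trial_mean.
Qed.

Lemma toC_sum (J : Type) (r : seq J) (v : J -> R * R) :
  toC (\sum_(j <- r) v j) = \sum_(j <- r) toC (v j).
Proof. exact: (big_morph toC (id1 := 0) (op1 := +%R)). Qed.

Lemma conjc_app_velocity (g : 'rV[R]_N) x :
  conjc (toC (app_velocity g x)) = - 'i * ((2 * pi)^-1)%:C *
    (N%:R^-1 * \sum_j (g 0 j)%:C / (toC x - zeta j)).
Proof.
rewrite /app_velocity toCZ conjcM conjc_real toC_sum conjc_sum.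
rewrite mulrAC mulrC; congr (_ * _); rewrite !mulr_sumr; apply: eq_bigr => j _.
rewrite toCZ conjcM conjc_real toC_perp conjcM conjc_i conjc_toC_inversion toCB.
by rewrite rmorphM fmorphV rmorph_nat; ring.
Qed.

(** The singular kernels of the exterior and plane velocities cancel. The total vorticity at the
    origin is moved under the integral, so that each source carries its complete image field 1 / z -
    1 / (z - u). *)
Lemma conjc_remainder_velocity x : (forall y, w y != 0 -> Omega y) ->
  s <= enorm x ->
  superposable w (fun y => (toC x)^-1 - (toC x - (conjc (toC y))^-1)^-1) /\
  conjc (toC (remainder_velocity w gamma x)) =
  - 'i * ((2 * pi)^-1)%:C * (gamma%:C / toC x +
    I (fun y => (toC x)^-1 - (toC x - (conjc (toC y))^-1)^-1)).
Proof.
move=> wO sx; have sz : s <= nr (toC x) by rewrite normc_toC.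
have cmI : cmeasurable (fun y => (toC x - (conjc (toC y))^-1)^-1).
  apply: cmeasurableV; apply: cmeasurableD; first exact: cmeasurable_cst.
  by apply/cmeasurableN/cmeasurableV/cmeasurable_conjc; exact: cmeasurable_toC.
have spI : superposable w (fun y => (toC x - (conjc (toC y))^-1)^-1).
  apply: (superposable_bounded L_ge0 w_src (b := (s - 1)^-1)) => // y /far sy.
  apply: far_from_circle_inv => //; apply: (far_inv s_gt1).
  by rewrite normc_conjc.
have sp1 : superposable w (fun=> 1).
  apply: (superposable_bounded L_ge0 w_src (b := 1)).
    exact: cmeasurable_cst.
  by move=> y _; rewrite Normc.normc1.
have spK : superposable w (fun y => (toC x - toC y)^-1).
  exact: superposable_singular L_ge0 w_src.
have spX : superposable w (fun y => (toC x)^-1 * 1) by exact: superposableZ.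
have spN : superposable w (fun y => -1 * (toC x - (conjc (toC y))^-1)^-1).
  exact: superposableZ.
have TE : (fun y => (toC x)^-1 - (toC x - (conjc (toC y))^-1)^-1) =
    (fun y => (toC x)^-1 * 1 + -1 * (toC x - (conjc (toC y))^-1)^-1).
  by apply/funext => y; rewrite mulr1 mulN1r.
split; first by rewrite TE; exact: superposableD.
rewrite /remainder_velocity toCB conjcB conjc_exterior_velocity//.
rewrite conjc_plane_velocity -mulrBr; congr (_ * _).
have -> : I (fun y => (toC x - toC y)^-1 - (toC x - (conjc (toC y))^-1)^-1) =
    I (fun y => (toC x - toC y)^-1 + -1 * (toC x - (conjc (toC y))^-1)^-1).
  by apply: eq_superpose => y _; rewrite mulN1r.
by rewrite TE !superposeD// !superposeZ//; ring.
Qed.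

Lemma velocity_error (g : 'rV[R]_N) x : (forall y, w y != 0 -> Omega y) ->
  s <= enorm x -> vortex_system w gamma g ->
  enorm (remainder_velocity w gamma x - app_velocity g x) <=
  (2 * pi)^-1 * (`|gamma| * err
    + 2 * (2 * err / (s - 1) + N%:R * (s ^+ N * err ^+ 2)) * mass
    + (4 * err * mass + 4 * (4 * (N%:R * err) * ((s - 1)^-1 + 1) * mass)) / (s - 1)).
Proof.
move=> wO sx gsys; have sz : s <= nr (toC x) by rewrite normc_toC.
have [spT TE] := conjc_remainder_velocity wO sx.
rewrite -normc_toC -normc_conjc toCB conjcB TE conjc_app_velocity -mulrBr.
set T := fun y => _ in spT *.
pose A y := \sum_j (N%:R^-1 / (toC x - zeta j)) *
  (trial j (toC y) + conjc (trial j (toC y))).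
pose d j := g 0 j - trial_strength j.
have spC (j : 'I_N) : superposable w (fun y => trial j (toC y) + conjc (trial j (toC y))).
  exact: superposableD (sp_trial j) (superposable_conjc (sp_trial j)).
have spA : superposable w A by exact: superposable_sum.
have spB : superposable w (fun y => -1 * A y) by exact: superposableZ.
(* Each strength is the uniform sheet, the sheets of the sources and the deviation [d j]; the real
   part is written as a sum with the conjugate so as to match [exterior_trial]. *)
have gE j : (g 0 j)%:C = gamma%:C + (d j)%:C +
    I (fun y => trial j (toC y) + conjc (trial j (toC y))).
  have spc := superposable_conjc (sp_trial j).
  rewrite superposeD// superpose_conjc// addcJ.
  transitivity ((gamma + d j + 2 * Re (trial_coef j))%:C).
    by congr (_%:C); rewrite /d /trial_strength; ring.
  by rewrite !rmorphD rmorphM rmorph_nat.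
(* Three independent errors, one for each summand of the bound: quadrature of the uniform sheet,
   quadrature of the source sheets, and deviation of the solution from the trial. *)
have -> : gamma%:C / toC x + I T - N%:R^-1 * (\sum_j (g 0 j)%:C / (toC x - zeta j)) =
    gamma%:C * ((toC x)^-1 - N%:R^-1 * \sum_j (toC x - zeta j)^-1)
    + I (fun y => T y + -1 * A y)
    - N%:R^-1 * \sum_j (d j)%:C / (toC x - zeta j).
  rewrite (superposeD spT spB) (superposeZ _ spA) (superpose_sum _ spC).
  have -> : N%:R^-1 * (\sum_j (g 0 j)%:C / (toC x - zeta j)) =
    gamma%:C * (N%:R^-1 * \sum_j (toC x - zeta j)^-1)
    + \sum_j (N%:R^-1 / (toC x - zeta j)) *
       I (fun y => trial j (toC y) + conjc (trial j (toC y)))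
    + N%:R^-1 * \sum_j (d j)%:C / (toC x - zeta j).
    rewrite !mulr_sumr -!big_split/=; apply: eq_bigr => j _.
    by rewrite gE; ring.
  by ring.
rewrite Normc.normcM Normc.normcM normcN.
have -> : nr 'i = 1 by rewrite /= expr0n/= add0r expr1n sqrtr1.
rewrite mul1r normc_real ger0_norm; last by rewrite invr_ge0 mulr_ge0// pi_ge0.
rewrite ler_wpM2l ?invr_ge0 ?mulr_ge0 ?pi_ge0//.
apply: le_trans (le_normcB _ _) _; apply: lerD.
  apply: le_trans (le_normcD _ _) _; apply: lerD.
    rewrite (exterior_uniform n s_gt1 sz) Normc.normcM normc_real ler_wpM2l//.
    rewrite normcN Normc.normcM -[leRHS]mul1r.
    by apply: ler_pM; rewrite ?normc_ge0//; [exact: far_inv sz|exact: far_err].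
  apply: (superpose_le L_ge0 w_src).
    exact: superposableD.
  move=> y /far sy; apply: le_trans (exterior_trial_le n s_gt1 sz sy).
  rewrite le_eqVlt; apply/orP; left; apply/eqP; congr nr.
  rewrite /T mulN1r /A mulr_sumr; congr (_ - _); apply: eq_bigr => j _.
  by rewrite -mulrA; congr (_ * _); rewrite mulrC.
rewrite Normc.normcM Normc.normcV -(rmorph_nat (real_complex R)) normc_real.
rewrite (ger0_norm (ler0n _ _)) ler_pdivrMl ?ltr0n//.
apply: le_trans (le_normc_sum _ _ _) _.
rewrite [leRHS]mulr_natl; set D := _ / (s - 1).
rewrite -[X in D *+ X](card_ord N) -sumr_const.
apply: ler_sum => j _; rewrite Normc.normcM normc_real.
rewrite ler_pM ?normc_ge0//; first exact: strength_error.
by apply: far_from_circle_inv => //; rewrite normc_vortex.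
Qed.

End consistency.

(** * Geometric decay against powers of N *)

Lemma cube_le_geometric (R : realType) (s : R) : 1 < s ->
  exists2 B : R, 0 <= B & forall N, N%:R ^+ 3 <= B * s ^+ N.
Proof.
(* Bernoulli's inequality for 1 + a is cubed, so (1 + a)^3 <= s is needed; since a <= 1, the cube is
   at most 1 + (3 + 3 + 1) a, whence the 7. *)
move=> s1; pose a := Num.min 1 ((s - 1) / 7).
have a0 : 0 < a by rewrite lt_min ltr01 divr_gt0// subr_gt0.
have a1 : a <= 1 by rewrite ge_min lexx.
have a7 : 7 * a <= s - 1.
  by rewrite mulrC -ler_pdivlMr// /a ge_min lexx orbT.
have cube : (1 + a) ^+ 3 <= s.
  have a2 : a ^+ 2 <= a by rewrite expr2 -[leRHS]mulr1 ler_wpM2l// ltW.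
  have : a ^+ 3 <= a.
    by rewrite exprS -[leRHS]mulr1 ler_wpM2l ?(le_trans a2)// ltW.
  have -> : (1 + a) ^+ 3 = 1 + 3 * a + 3 * a ^+ 2 + a ^+ 3 by ring.
  lra.
have bern N : N%:R * a <= (1 + a) ^+ N.
  elim: N => [|N IH]; first by rewrite mul0r expr0.
  have : 1 <= (1 + a) ^+ N by rewrite exprn_ege1// lerDl ltW.
  rewrite exprS -natr1 mulrDl mul1r mulrDl mul1r => h.
  by rewrite lerD// -[leLHS]mulr1 ler_wpM2l// ltW.
exists (a ^+ 3)^-1 => [|N]; first by rewrite invr_ge0 exprn_ge0// ltW.
rewrite ler_pdivlMl ?exprn_gt0//.
apply: le_trans (_ : (1 + a) ^+ N ^+ 3 <= _).
  by rewrite -exprMn mulrC lerXn2r ?bern// nnegrE ?mulr_ge0 ?exprn_ge0 ?addr_ge0 ?(ltW a0).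
by rewrite -exprM mulnC exprM lerXn2r// nnegrE ?exprn_ge0 ?addr_ge0 ?ltW// (lt_trans _ s1).
Qed.

Lemma Linfty_norm_le (R : realType) (K : set (R * R)) (f : R * R -> R * R) (c : R) :
  0 <= c -> (forall x, K x -> enorm (f x) <= c) -> (Linfty_norm K f <= c%:E)%E.
Proof.
move=> c0 fc; rewrite /Linfty_norm unlock; case: ifPn => _; last by rewrite lee_fin.
apply/ess_supP; apply: nearW => x /=; rewrite lee_fin patchE.
case: ifPn => [/set_mem Kx|_]; last by rewrite normr0.
by rewrite /= ger0_norm ?enorm_ge0// fc.
Qed.

Section decay.
Context {R : realType} (s : R).
Hypothesis s_gt1 : 1 < s.

(** The value s / (s - 1) of s^N / (s^N - 1) at N = 1, which is its largest over N >= 1. *)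
Definition err_decay : R := (1 - s^-1)^-1.

Lemma err_decay_gt0 : 0 < err_decay.
Proof. by rewrite invr_gt0 subr_gt0 invf_lt1// (lt_trans _ s_gt1). Qed.

Lemma err_le n : err s n <= err_decay / s ^+ n.+1.
Proof.
have s0 : 0 < s by exact: lt_trans s_gt1.
have p1 : 0 < s ^+ n.+1 - 1 by rewrite subr_gt0 sN_gt1.
have p2 : 0 < (1 - s^-1) * s ^+ n.+1.
  by rewrite mulr_gt0 ?exprn_gt0// subr_gt0 invf_lt1.
rewrite /err /err_decay -invfM lef_pV2 ?posrE//.
rewrite mulrBl mul1r lerB// exprS mulKf ?gt_eqF//.
by rewrite exprn_ege1// ltW.
Qed.

(** The bound is monotone in err, N err and N s^N err^2. With k = [err_decay] and P = N / s^N these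
    are at most k P, k P and k^2 P, so P factors out. *)
Lemma velocity_error_decay (gamma W : R) n : 0 <= W ->
  (2 * pi)^-1 * (`|gamma| * err s n
    + 2 * (2 * err s n / (s - 1) + n.+1%:R * (s ^+ n.+1 * err s n ^+ 2)) * W
    + (4 * err s n * W
       + 4 * (4 * (n.+1%:R * err s n) * ((s - 1)^-1 + 1) * W)) / (s - 1))
  <= (2 * pi)^-1 * (`|gamma| * err_decay
    + 2 * (2 * err_decay / (s - 1) + err_decay ^+ 2) * W
    + (4 * err_decay * W
       + 4 * (4 * err_decay * ((s - 1)^-1 + 1) * W)) / (s - 1))
    * (n.+1%:R / s ^+ n.+1).
Proof.
move=> W0; have k_gt0 := err_decay_gt0; set N := n.+1%:R; set P := N / s ^+ n.+1; set k := err_decay.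
have s0 : 0 < s by exact: lt_trans s_gt1.
have sN0 : 0 < s ^+ n.+1 by rewrite exprn_gt0.
have N1 : 1 <= N :> R by rewrite ler1n.
have N0 : 0 <= N :> R by rewrite (le_trans _ N1).
have e0 : 0 <= err s n by exact/ltW/err_gt0.
have e1 : N * err s n <= k * P.
  by rewrite /P mulrCA ler_wpM2l// err_le.
have e2 : err s n <= k * P by apply: le_trans e1; rewrite ler_peMl.
have e3 : N * (s ^+ n.+1 * err s n ^+ 2) <= k ^+ 2 * P.
  rewrite /P [leRHS]mulrCA ler_wpM2l// mulrC expr2 -mulrA.
  apply: le_trans (_ : (k / s ^+ n.+1) * ((k / s ^+ n.+1) * s ^+ n.+1) <= _).
    apply: ler_pM => //; rewrite ?mulr_ge0 ?(ltW sN0) ?err_le//.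
    by rewrite ler_wpM2r ?err_le// ltW.
  by rewrite divfK ?gt_eqF// mulrC expr2 mulrA.
have i1 : 0 <= (s - 1)^-1 by rewrite invr_ge0 subr_ge0 ltW.
rewrite -[leRHS]mulrA ler_wpM2l ?invr_ge0 ?mulr_ge0 ?pi_ge0//.
move: (err s n) (N * err s n) (N * (_ * _)) (s - 1)^-1 e0 e1 e2 e3 i1.
move=> e Ne Se r e0 e1 e2 e3 r0.
have -> : (`|gamma| * k + 2 * (2 * k * r + k ^+ 2) * W
    + (4 * k * W + 4 * (4 * k * (r + 1) * W)) * r) * P =
  `|gamma| * (k * P) + 2 * (2 * (k * P) * r + k ^+ 2 * P) * W
    + (4 * (k * P) * W + 4 * (4 * (k * P) * (r + 1) * W)) * r by ring.
apply: lerD; first apply: lerD.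
- by rewrite ler_wpM2l.
- by rewrite ler_wpM2r// ler_wpM2l// lerD// ler_wpM2r// ler_wpM2l.
- rewrite ler_wpM2r// lerD//; first by rewrite ler_wpM2r// ler_wpM2l.
  by rewrite ler_wpM2l// ler_wpM2r// ler_wpM2r ?addr_ge0// ler_wpM2l.
Qed.

End decay.

Theorem theorem1p1 (R : realType) (alpha : R) (w : R * R -> R) (gamma : R) :
  0 < alpha <= 1 -> holder_c alpha w ->
  (forall N : nat, (2 <= N)%N ->
     exists! g : 'rV[R]_N, vortex_system w gamma g)
  /\
  (forall K : set (R * R), closed K -> K `<=` Omega ->
     exists C : R, forall N : nat, (2 <= N)%N ->
       forall g : 'rV[R]_N, vortex_system w gamma g ->
       (Linfty_norm K (fun x => remainder_velocity w gamma x - app_velocity g x)%R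
          <= (C / N%:R ^+ 2)%:E)%E).
Proof.
move=> a01 wa; split.
  move=> [//|n] _.
  have [g [gP gU]] := tangency_solvable (fun i : 'I_n.+1 =>
    - (2 * pi * n.+1%:R * dot (plane_velocity w (midpoint i)) (normal (midpoint i))))
    (n.+1%:R * gamma).
  exists g; split; first exact/vortex_systemE.
  by move=> g' /vortex_systemE; exact: gU.
move=> K cK KO; have [r r1 Kr] := closed_Omega_gap cK KO.
have [t [M [L [t1 M0 L0 wb]]]] := holder_c_bounds a01 wa.
(* One radius for both the points of [K] and the support of w: the lower bounds on the norm survive
   when s decreases. *)
pose s := Num.min r t; have s1 : 1 < s by rewrite lt_min r1 t1.
have ws : source_bounds w s M L.
  case: wb => mw wM ws wL; split => // y /ws.
  by apply: le_trans; rewrite ge_min lexx orbT.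
have wO y : w y != 0 -> Omega y.
  by move=> y0; case: wa => _ + _; apply; exact: subset_closure.
have [B B0 sB] := cube_le_geometric s1.
pose Q := (2 * pi)^-1 * (`|gamma| * err_decay s
    + 2 * (2 * err_decay s / (s - 1) + err_decay s ^+ 2) * mass w
    + (4 * err_decay s * mass w
       + 4 * (4 * err_decay s * ((s - 1)^-1 + 1) * mass w)) / (s - 1)).
have W0 := mass_ge0 w.
have Q0 : 0 <= Q.
  have k0 : 0 <= err_decay s by exact/ltW/err_decay_gt0.
  have i1 : 0 <= (s - 1)^-1 by rewrite invr_ge0 subr_ge0 ltW.
  rewrite /Q mulr_ge0 ?invr_ge0 ?mulr_ge0 ?pi_ge0//.
  move: (err_decay s) (s - 1)^-1 (mass w) k0 i1 W0 => k i W k0 i0 W0'.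
  by repeat first [apply: addr_ge0 | apply: mulr_ge0 | apply: exprn_ge0 | by []].
(* The error is at most Q N / s^N, and N^3 <= B s^N turns this into Q B / N^2. This is why a cube is
   compared with the geometric growth. *)
exists (Q * B) => -[//|n] _ g gsys; apply: Linfty_norm_le.
  by apply: divr_ge0; [exact: mulr_ge0|exact: exprn_ge0].
move=> x Kx; have sx : s <= enorm x.
  by apply: le_trans (Kr _ Kx); rewrite ge_min lexx.
apply: le_trans (velocity_error s1 L0 ws wO sx gsys) _.
apply: le_trans (velocity_error_decay s1 gamma n W0) _.
rewrite -/Q -[leRHS]mulrA ler_wpM2l//.
rewrite ler_pdivrMr; last by rewrite exprn_gt0// (lt_trans _ s1).
rewrite mulrAC ler_pdivlMr ?exprn_gt0 ?ltr0n//.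
by rewrite -exprS.
Qed.
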